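(* Let $B>1$ be a base, let $X_1,X_2,\dots$ be independent continuous real-valued random variables, and for each $m\ge 1$ let $g_{B,m}$ be the density on $[0,1)$ of $\log_B M_B(|X_m|)$. Then the distribution of the digits of the product $X_1\cdots X_M$ converges to Benford's Law (base $B$) as $M\to\infty$ in $L^1([0,1])$ if and only if for each integer $n\neq 0$ we have $$\lim_{M\to\infty}\widehat{g_{B,1}}(n)\,\widehat{g_{B,2}}(n)\cdots\widehat{g_{B,M}}(n)=0.$$
   Context: A continuous random variable means one whose distribution has a density with respect to Lebesgue measure (so each $X_m$ is nonzero almost surely). For a base $B$, every $x>0$ is written uniquely as $x=M_B(x)\cdot B^k$ with $k\in\mathbb{Z}$ and mantissa $M_B(x)\in[1,B)$. Benford's Law base $B$ is the law under which the mantissa is at most $s$ with probability $\log_B s$ for $s\in[1,B)$; equivalently, the base-$B$ logarithm of the mantissa is uniformly distributed on $[0,1)$. The distribution of the digits of $X_1\cdots X_M$ converges to Benford's Law base $B$ in $L^1([0,1])$ means: if $h_M$ denotes the density on $[0,1)$ of $\log_B M_B(|X_1\cdots X_M|)$ (equivalently of $\log_B|X_1\cdots X_M| \bmod 1$), then $\lim_{M\to\infty}\int_0^1|h_M(x)-1|\,dx=0$. For a probability density $g$ on $[0,1]$ and $n\in\mathbb{Z}$, $\widehat{g}(n)=\int_0^1 g(x)e^{-2\pi i n x}\,dx$. *)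

(* Defs.v *)
From HB Require Import structures.
From mathcomp Require Import all_boot all_order all_algebra.
From mathcomp Require Import complex.
From mathcomp Require Import all_classical all_reals all_analysis.

Set Implicit Arguments.
Unset Strict Implicit.
Unset Printing Implicit Defensive.
Import Order.TTheory GRing.Theory Num.Theory.
Import numFieldNormedType.Exports.
Local Open Scope classical_set_scope.
Local Open Scope complex_scope.
Local Open Scope ring_scope.

Definition logb (R : realType) (B x : R) : R := ln x / ln B.

(* The mantissa of x > 0 in base B > 1; [mantissaP] below shows that this is
   the unique M in [1, B[ with x = M * B ^ k for some integer k.  The value at
   x <= 0 is junk. *)
Definition mantissa (R : realType) (B x : R) : R :=
  x / B ^ Num.floor (logb B x).

Lemma mantissaP (R : realType) (B x : R) : 1 < B -> 0 < x ->
  [/\ 1 <= mantissa B x < B,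
      exists k : int, x = mantissa B x * B ^ k &
      forall (M : R) (k : int), 1 <= M < B -> x = M * B ^ k ->
        M = mantissa B x].
Proof.
move=> B1 x0; have B0 : 0 < B by apply: lt_trans B1.
have lnB : 0 < ln B by rewrite ln_gt0.
have Bk k : 0 < B ^ k by rewrite exprz_gt0.
have lnX (k : int) : ln (B ^ k) = k%:~R * ln B.
  by rewrite -powR_intmul ?(ltW B0)// ln_powR.
have floorE (M : R) (k : int) : 1 <= M < B -> x = M * B ^ k ->
    Num.floor (logb B x) = k.
  move=> /andP[M1 MB] xE; have M0 : 0 < M by apply: lt_le_trans M1.
  apply: floor_def; rewrite /logb xE lnM ?posrE// lnX mulrDl mulfK ?gt_eqF//.
  rewrite lerDr intrD (addrC _ 1) ltrD2r divr_ge0 ?(ltW lnB) ?(ln_ge0 M1)//=.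
  by rewrite ltr_pdivrMr// mul1r ltr_ln ?posrE.
split.
- have /andP[] := floor_itv (logb B x); rewrite /mantissa.
  set k := Num.floor _ => kx xk.
  rewrite ler_pdivlMr// mul1r ltr_pdivrMr//.
  rewrite -[X in X <= _]lnK ?posrE// -[X in _ <= X]lnK ?posrE// ler_expR.
  rewrite lnX -ler_pdivlMr// kx/=.
  rewrite -{1}(expr1z B) -expfzDr ?gt_eqF// addrC.
  rewrite -[X in X < _]lnK ?posrE// -[X in _ < X]lnK ?posrE// ltr_expR.
  by rewrite lnX -ltr_pdivrMr.
- by exists (Num.floor (logb B x)); rewrite /mantissa divfK ?gt_eqF.
- move=> M k Mi xE; rewrite /mantissa (floorE _ _ Mi xE) xE mulfK//.
  by rewrite gt_eqF.
Qed.

Definition log_mantissa (R : realType) (B x : R) : R :=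
  logb B (mantissa B `|x|).

(* [f] is a density on [D] of the law of [Y]: the law is carried by [D] and is
   [f] times Lebesgue measure there.  Values of [f] off [D] are irrelevant. *)
Definition is_density (d : measure_display) (T : measurableType d)
    (R : realType) (P : probability T R) (D : set R) (Y : T -> R)
    (f : R -> R) : Prop :=
  [/\ measurable_fun D f,
      forall x, D x -> 0 <= f x &
      forall A : set R, measurable A ->
        P (Y @^-1` A) = (\int[lebesgue_measure]_(x in D `&` A) (f x)%:E)%E].

Definition continuous_RV (d : measure_display) (T : measurableType d)
    (R : realType) (P : probability T R) (Y : {RV P >-> R}) : Prop :=
  exists f : R -> R, is_density P setT Y f.

Definition independent_RVs (d : measure_display) (T : measurableType d)
    (R : realType) (P : probability T R) (X : nat -> {RV P >-> R}) : Prop :=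
  forall (J : seq nat) (A : nat -> set R), uniq J ->
    (forall j, measurable (A j)) ->
    P (\bigcap_(j in [set` J]) (X j @^-1` A j)) =
    (\prod_(j <- J) P (X j @^-1` A j))%E.

(* The digits of the products Y 1, Y 2, ... converge to Benford's law in L^1:
   log_B of the mantissa of |Y M| has a density h M on [0, 1[ for each M >= 1,
   and h M tends to 1 in L^1.  Densities being unique almost everywhere, the
   choice of h does not matter. *)
Definition cvg_benford_L1 (d : measure_display) (T : measurableType d)
    (R : realType) (P : probability T R) (B : R) (Y : nat -> T -> R) : Prop :=
  exists h : nat -> R -> R,
    (forall M, (0 < M)%N ->
      is_density P `[0, 1[ (fun t => log_mantissa B (Y M t)) (h M)) /\
    (\int[lebesgue_measure]_(x in `[0%R, 1%R[) `|h M x - 1|%:E)%E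
      @[M --> \oo] --> 0%E.

Definition expi (R : realType) (t : R) : R[i] := cos t +i* sin t.

Definition cintegral (R : realType) (D : set R) (f : R -> R[i]) : R[i] :=
  Rintegral lebesgue_measure D (fun x => complex.Re (f x)) +i*
  Rintegral lebesgue_measure D (fun x => complex.Im (f x)).

Definition fourier_coef (R : realType) (g : R -> R) (n : int) : R[i] :=
  cintegral `[0, 1[ (fun x => (g x)%:C * expi (- (2 * pi * n%:~R * x))).

(* Main.v *)
Require Import Defs.
From HB Require Import structures.
From mathcomp Require Import all_boot all_order all_algebra.
From mathcomp Require Import complex ring lra.
From mathcomp Require Import all_classical all_reals all_analysis.
From mathcomp Require Import measurable_realfun.

(* Let L_m = log_B |X_m| and S_M = L_1 + ... + L_M, so that almost surely the
   log-mantissa of X_1 ... X_M is S_M mod 1, and by independence the product of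
   the Fourier coefficients is the n-th Fourier coefficient of the law of
   S_M mod 1; the L^1 distance to 1 bounds the latter.
   Conversely, write g for the density of L_1 mod 1 and let K >= 0 be a
   trigonometric polynomial with integral 1.  Since S_M = L_1 + V with V
   independent of L_1, convolving the law of S_M mod 1 with K moves it by at
   most Q = int int K(x - u) |g(x) - g(u)| dx du in total variation, uniformly
   in M, and Q is small when K is an approximate unit.  The convolved density
   at x is E K(x - S_M), a fixed finite combination of Fourier coefficients of
   S_M mod 1, hence it tends to 1 uniformly in x.  Convolving with a
   trigonometric polynomial avoids dividing by the Fourier coefficients of g,
   some of which may vanish. *)

Set Implicit Arguments.
Unset Strict Implicit.
Unset Printing Implicit Defensive.
Import Order.TTheory GRing.Theory Num.Theory.
Import numFieldNormedType.Exports.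
Local Open Scope classical_set_scope.
Local Open Scope complex_scope.
Local Open Scope ring_scope.

(** * The circle as the unit interval with Lebesgue measure *)

(** Decay of the Fourier coefficients alone gives only weak convergence. Reaching L^1 needs some
    regularity common to all M, and one factor supplies it: the law of S_M mod 1 is always an
    average of translates of g, and Q sees only g, never the law of V. Total variation enters in a
    one-sided form: for a probability density h on the circle, the integral of |h - 1| is twice |A|
    - P(A) with A = {h < 1}, so lower bounds on P(A) suffice. Identities are proved first for
    nonnegative extended-real functions, where Tonelli applies freely; a function F with |F| <= 1 is
    then reached through 1 + F. *)

Definition fracpart (R : realType) (x : R) : R := x - (Num.floor x)%:~R.

Lemma fracpart_ge0 (R : realType) (x : R) : 0 <= fracpart x.
Proof. by rewrite /fracpart subr_ge0; have /andP[] := floor_itv x. Qed.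

Lemma fracpart_lt1 (R : realType) (x : R) : fracpart x < 1.
Proof.
by rewrite /fracpart ltrBlDl; have /andP[_] := floor_itv x; rewrite intrD.
Qed.

Lemma fracpart_itv (R : realType) (x : R) : `[0, 1[%classic (fracpart x).
Proof. by rewrite /= in_itv/= fracpart_ge0 fracpart_lt1. Qed.

Lemma fracpart_id (R : realType) (x : R) : 0 <= x < 1 -> fracpart x = x.
Proof. by move=> x01; rewrite /fracpart (floor_def (m := 0)) ?subr0// add0r. Qed.

Lemma fracpartDz (R : realType) (x : R) (k : int) : fracpart (x + k%:~R) = fracpart x.
Proof.
by rewrite /fracpart floorDrz ?intr_int// intrKfloor intrD opprD addrACA subrr addr0.
Qed.

Lemma fracpartE (R : realType) (x : R) : exists k : int, fracpart x = x + k%:~R.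
Proof. by exists (- Num.floor x); rewrite /fracpart intrN. Qed.

Lemma fracpart_fracpartDl (R : realType) (x y : R) : fracpart (fracpart x + y) = fracpart (x + y).
Proof. by have [k ->] := fracpartE x; rewrite addrAC fracpartDz. Qed.

Lemma fracpart_fracpartDr (R : realType) (x y : R) : fracpart (x + fracpart y) = fracpart (x + y).
Proof. by rewrite addrC fracpart_fracpartDl addrC. Qed.

Lemma measurable_fracpart (R : realType) : measurable_fun [set: R] (@fracpart R).
Proof.
apply: measurable_funB => //; apply: nondecreasing_measurable => // x y xy.
by rewrite ler_int le_floor.
Qed.

(* Integrals over the circle are expectations under the uniform law, so that
   they are over setT, as the Fubini theorems require. *)
Notation unif R := (uniform_prob (@ltr01 R)).

Lemma integral_unif (R : realType) (F : R -> \bar R) :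
  measurable_fun setT F -> (forall x, 0 <= F x)%E ->
  (\int[unif R]_x F x = \int[lebesgue_measure]_(x in `[0%R, 1%R[) F x)%E.
Proof.
move=> mF F0; rewrite integral_uniform// subr0 invr1 mul1e.
by rewrite integral_itv_bndo_bndc//; exact: measurable_funTS.
Qed.

(** The image of Lebesgue measure under a translation agrees with it on half-open intervals, hence
    everywhere by uniqueness. *)
Lemma ge0_integral_translation (R : realType) (F : R -> \bar R) (c : R)
    (D : set R) : measurable D ->
  measurable_fun setT F -> (forall x, 0 <= F x)%E ->
  (\int[lebesgue_measure]_(x in [set x | D (x + c)%R]) F (x + c)%R =
   \int[lebesgue_measure]_(x in D) F x)%E.
Proof.
move=> mD mF F0.
have mc : measurable_fun [set: measurableTypeR R]
    (fun x : measurableTypeR R => (x + c)%R : measurableTypeR R).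
  exact: measurable_funD.
have -> : (\int[lebesgue_measure]_(x in D) F x =
    \int[pushforward lebesgue_measure
           (fun x : measurableTypeR R => (x + c)%R : measurableTypeR R)]_(x in D)
      F x)%E.
  apply: eq_measure_integral => /= A mA _; apply: lebesgue_measure_unique => //.
  move=> _ [[a b] _ <-]/=; rewrite /pushforward/=.
  have -> : (fun x => x + c) @^-1` `]a, b] = `]a - c, b - c]%classic.
    by apply/seteqP; split=> x/=; rewrite !in_itv/= ltrBlDr lerBrDr.
  rewrite !lebesgue_measure_itv/= !lte_fin ltrD2r.
  by case: ifP => // _; rewrite -!EFinB; congr EFin; rewrite opprB addrA addrNK.
rewrite (ge0_integral_pushforward mc)//; exact: measurable_funTS.
Qed.

Lemma ge0_integral_itv_cat (R : realType) (F : R -> \bar R) (a b c : R) :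
  a <= b <= c -> measurable_fun setT F -> (forall x, 0 <= F x)%E ->
  (\int[lebesgue_measure]_(x in `[a, c[) F x =
   \int[lebesgue_measure]_(x in `[a, b[) F x +
   \int[lebesgue_measure]_(x in `[b, c[) F x)%E.
Proof.
move=> /andP[ab bc] mF F0; rewrite -ge0_integral_setU//=; last 2 first.
  exact: measurable_funTS.
  apply/disj_setPS => x [/=]; rewrite !in_itv/= => /andP[_ xb] /andP[bx _].
  by move: (lt_le_trans xb bx); rewrite ltxx.
congr integral; apply/seteqP; split=> x/=; rewrite !in_itv/=.
  by move=> /andP[-> ->]; case: (ltP x b) => _; [left|right].
case=> /andP[p q]; first by rewrite p (lt_le_trans q).
by rewrite q andbT (le_trans ab).
Qed.

(** Rotation invariance. For v in [0, 1[ the arcs [0, 1 - v[ and [1 - v, 1[ are carried onto [v, 1[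
    and [0, v[, the second one by the translation v - 1; the two pieces change order. *)
Lemma ge0_integral_unif_rot (R : realType) (F : R -> \bar R) (v : R) :
  measurable_fun setT F -> (forall x, 0 <= F x)%E ->
  (\int[unif R]_x F (fracpart (x + v)%R) = \int[unif R]_x F (fracpart x))%E.
Proof.
move=> mF F0.
have mF0 := measurableT_comp mF (@measurable_fracpart R).
have mFr (w : R) : measurable_fun setT (fun x : R => F (fracpart (x + w)%R)).
  by apply: (measurableT_comp mF0); exact: measurable_funD.
rewrite !integral_unif//.
under eq_integral do rewrite -fracpart_fracpartDr.
move: (fracpart v) (fracpart_ge0 v) (fracpart_lt1 v) => {}v v0 v1.
rewrite (@ge0_integral_itv_cat _ _ 0 (1 - v) 1)//; last first.
  by rewrite subr_ge0 (ltW v1)/= gerBl.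
rewrite [RHS](@ge0_integral_itv_cat _ _ 0 v 1)//; last by rewrite v0 ltW.
rewrite addeC; congr (_ + _)%E.
  rewrite -(@ge0_integral_translation _ (fun x => F (fracpart x)) (v - 1))//.
  have -> : [set x : R | `[0, v[%classic (x + (v - 1))%R] = `[1 - v, 1[%classic.
    by apply/seteqP; split=> x/=; rewrite !in_itv/= => /andP[a b];
      apply/andP; split; lra.
  apply: eq_integral => x _; congr F.
  by rewrite addrA -[X in _ - X]/(1%:~R) -intrN fracpartDz.
rewrite -(@ge0_integral_translation _ (fun x => F (fracpart x)) v)//.
congr integral; apply/seteqP.
by split=> x/=; rewrite !in_itv/= lerDr ltrBrDr.
Qed.

(** * Integration against a density *)

Section density.
Import HBNNSimple.
Local Open Scope ereal_scope.
Context (d : measure_display) (T : measurableType d) (R : realType)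
  (P : probability T R) (D : set R) (Y : T -> R) (f : R -> R).
Hypotheses (mD : measurable D) (mY : measurable_fun setT Y)
  (Yf : is_density P D Y f).

Let mf : measurable_fun D (fun x => (f x)%:E).
Proof. by case: Yf => /measurable_EFinP. Qed.

Let f0 x : D x -> 0 <= (f x)%:E.
Proof. by move=> Dx; rewrite lee_fin; case: Yf => _ /(_ _ Dx). Qed.

Let integral_density_indic (A : set R) : measurable A ->
  \int[P]_t (\1_A (Y t))%:E = \int[lebesgue_measure]_(x in D) ((\1_A x)%:E * (f x)%:E).
Proof.
move=> mA; transitivity (P (Y @^-1` A)).
  transitivity (\int[P]_t (\1_(Y @^-1` A) t)%:E); first exact: eq_integral.
  rewrite integral_indic ?setIT//.
  by rewrite -[X in measurable X]setTI; exact: mY.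
case: Yf => _ _ ->//; rewrite setIC integral_mkcondl; apply: eq_integral => x _.
by rewrite patchE indicE; case: ifP => _; rewrite ?mul1e ?mul0e.
Qed.

Let integral_density_nnsfun (s : {nnsfun R >-> R}) :
  \int[P]_t (s (Y t))%:E = \int[lebesgue_measure]_(x in D) ((s x)%:E * (f x)%:E).
Proof.
have ms (r : R) : measurable (s @^-1` [set r]) by [].
under [LHS]eq_integral do rewrite fimfunE -fsumEFin//.
rewrite [LHS]ge0_integral_fsum//; last 2 first.
  - move=> r; apply/measurable_EFinP/measurable_funM => //.
    exact: (measurableT_comp (measurable_indic (ms r))).
  - by move=> r t _; rewrite EFinM nnfun_muleindic_ge0.
under [RHS]eq_integral => x xD.
  rewrite fimfunE -fsumEFin// muleC ge0_mule_fsumr; last first.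
    by move=> y; rewrite EFinM nnfun_muleindic_ge0.
  over.
rewrite [RHS]ge0_integral_fsum//; last 2 first.
  - move=> r; apply: emeasurable_funM => //; apply/measurable_EFinP/measurable_funM => //.
    by apply: measurable_funTS; exact: (measurable_indic (ms r)).
  - by move=> y x Dx; apply: mule_ge0; rewrite ?f0// EFinM nnfun_muleindic_ge0.
apply: eq_fsbigr => r _.
(* A nonnegative simple function has empty fibres over negative r, so only r >= 0 is left, and such
   an r can be pulled out of a nonnegative integral. *)
have [r0|r0] := leP 0%R r; last first.
  rewrite preimage_nnfun0//.
  by rewrite !integral0_eq// => x _; rewrite indic0 mulr0 ?mule0.
under [LHS]eq_integral do rewrite EFinM.
rewrite ge0_integralZl//; last first.
  by apply/measurable_EFinP; exact: (measurableT_comp (measurable_indic (ms r))).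
rewrite integral_density_indic// -ge0_integralZl//; last 2 first.
  apply: emeasurable_funM => //; apply/measurable_EFinP/measurable_funTS; exact: (measurable_indic (ms r)).
  by move=> x Dx; rewrite mule_ge0 ?f0// lee_fin.
by apply: eq_integral => x _; rewrite EFinM [RHS]muleC muleA.
Qed.

(** [is_density] is the case of indicators; linearity extends it to simple functions, and monotone
    convergence on both sides to F. *)
Lemma ge0_integral_density (F : R -> \bar R) :
  measurable_fun setT F -> (forall x, 0 <= F x) ->
  \int[P]_t F (Y t) = \int[lebesgue_measure]_(x in D) (F x * (f x)%:E).
Proof.
move=> mF F0; pose s := nnsfun_approx measurableT mF.
have sF x : (s n x)%:E @[n --> \oo] --> F x by exact: cvg_nnsfun_approx.
have msn n : measurable_fun [set: R] (s n) by exact: measurable_funP.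
have nds x : {homo (fun n => s n x) : m n / (m <= n)%N >-> (m <= n)%R}.
  by move=> m n mn; exact/lefP/nd_nnsfun_approx.
transitivity (limn (fun n => \int[P]_t (s n (Y t))%:E)).
  rewrite -monotone_convergence//=.
  - by apply: eq_integral => t _; apply/esym/cvg_lim.
  - by move=> n; exact/measurable_EFinP/measurableT_comp.
  - by move=> n t _; rewrite lee_fin.
  - by move=> t _ m n mn; rewrite lee_fin nds.
under eq_fun do rewrite integral_density_nnsfun.
rewrite -monotone_convergence//=.
- apply: eq_integral => x; rewrite inE => Dx; apply/cvg_lim => //.
  exact: cvgeZr.
- move=> n; apply: emeasurable_funM => //.
  by apply/measurable_EFinP; exact: (measurable_funTS (msn n)).
- by move=> n x Dx; rewrite mule_ge0 ?f0// lee_fin.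
- by move=> x Dx m n mn; rewrite lee_wpmul2r ?f0// lee_fin nds.
Qed.

End density.

(** * Independence *)

Section independence.
Context (d : measure_display) (T : measurableType d) (R : realType)
  (P : probability T R).

Definition indep2 (U V : T -> R) := forall A B : set R,
  measurable A -> measurable B ->
  P (U @^-1` A `&` V @^-1` B) = (P (U @^-1` A) * P (V @^-1` B))%E.

(** Independence says that the joint law of (U, V) agrees with the product of the marginals on
    rectangles, hence is that product; Tonelli does the rest. *)
Lemma indep2_ge0_integral (U V : T -> R) (F : R * R -> \bar R) :
  measurable_fun setT U -> measurable_fun setT V -> indep2 U V ->
  measurable_fun setT F -> (forall x, 0 <= F x)%E ->
  (\int[P]_t F (U t, V t) = \int[P]_t \int[P]_s F (U s, V t))%E.
Proof.
move=> mU mV UV mF F0.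
have mUV : measurable_fun setT (fun t => (U t, V t)).
  exact/measurable_fun_pairP.
pose U' : {mfun T >-> R} := mfun_Sub (mem_set mU).
pose V' : {mfun T >-> R} := mfun_Sub (mem_set mV).
pose W' : {mfun T >-> (R * R)%type} := mfun_Sub (mem_set mUV).
transitivity (\int[distribution P W']_z F z)%E.
  by rewrite ge0_integral_distribution.
transitivity (\int[(distribution P U' \x distribution P V')%E]_z F z)%E.
  apply: eq_measure_integral => /= A mA _; apply/esym.
  by apply: product_measure_unique => // B C mB mC; exact: UV.
rewrite fubini_tonelli2// ge0_integral_distribution//; last 2 first.
  exact: measurable_fun_fubini_tonelli_G.
  by move=> y; apply: integral_ge0.
apply: eq_integral => t _; rewrite /= /fubini_G ge0_integral_distribution//.
exact: measurableT_comp.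
Qed.

(** A pi-system argument. With D the event on the k-th variable, the measures P(. & D) and P(D) P(.)
    agree on the cylinders over [s], which are stable under intersection, so they agree on the
    sigma-algebra that these generate, and the sum is measurable for it. *)
Lemma indep2_sum (X : nat -> {RV P >-> R}) (phi : R -> R) (k : nat)
    (s : seq nat) :
  independent_RVs X -> measurable_fun setT phi -> uniq s -> k \notin s ->
  indep2 (fun t => phi (X k t)) (fun t => \sum_(j <- s) phi (X j t)).
Proof.
move=> iX mphi us ks A B mA mB.
have mpre (C : set R) j : measurable C -> measurable (X j @^-1` C).
  by move=> mC; exact: measurable_funPTI.
set D := _ @^-1` A.
have DE : D = X k @^-1` (phi @^-1` A) by [].
have mphiA : measurable (phi @^-1` A) by rewrite -[X in measurable X]setTI; exact: mphi.
have mD : measurable D by rewrite DE; exact: mpre.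
pose r : {nonneg R} := NngNum (fine_ge0 (measure_ge0 P D)).
pose cyl (A : nat -> set R) := \bigcap_(j in [set` s]) (X j @^-1` A j).
pose G : set (set T) := [set E | exists A : nat -> set R,
  (forall j, measurable (A j)) /\ E = cyl A].
have mV : measurable_fun [set: g_sigma_algebraType G]
    ((fun t => \sum_(j <- s) phi (X j t)) : g_sigma_algebraType G -> R).
  (* The guard makes every summand measurable for the cylinders, including those with an index
     outside [s]. *)
  rewrite [X in measurable_fun _ X](_ : _ = (fun t : g_sigma_algebraType G =>
    \sum_(j <- s) if j \in s then phi (X j t) else 0)); last first.
    by apply/funext => t; apply: eq_big_seq => j ->.
  apply: measurable_sum => j; case: (boolP (j \in s)) => // js.
  apply: (measurableT_comp mphi) => _ C mC; rewrite setTI.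
  apply: sub_sigma_algebra; exists (fun i => if i == j then C else setT); split.
    by move=> i; case: ifP.
  apply/seteqP; split=> t /=.
    by move=> Xt i _ /=; case: eqP => // ->.
  by move=> /(_ j js) /=; rewrite eqxx.
suff : forall E, <<s G >> E -> mrestr P mD E = mscale r P E.
  move=> /(_ ((fun t => \sum_(j <- s) phi (X j t)) @^-1` B)).
  rewrite /mrestr /mscale/= fineK ?fin_num_measure// setIC; apply.
  by have := mV measurableT B mB; rewrite setTI; exact.
apply: (g_sigma_algebra_measure_unique G _ (fun=> setT)) => //.
- move=> _ [C [mC ->]]; apply: fin_bigcap_measurable => // j _; exact: mpre.
- move=> _; exists (fun=> setT); split=> //.
  by apply/seteqP; split.
- by apply/seteqP; split=> // t _; exists 0%N.
- move=> _ _ [C1 [mC1 ->]] [C2 [mC2 ->]].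
  exists (fun j => C1 j `&` C2 j); split; first by move=> j; exact: measurableI.
  by rewrite /cyl -bigcapI.
- move=> _ [C [mC ->]]; change (P (cyl C `&` D) = ((fine (P D))%:E * P (cyl C))%E); rewrite fineK ?fin_num_measure//.
  (* Placing the event of index k into the family turns the intersection with D into one cylinder
     over [k :: s], to which independence applies. *)
  pose C' j := if j == k then phi @^-1` A else C j.
  have C's j : j \in s -> C' j = C j.
    by rewrite /C'; case: eqP => // ->; rewrite (negbTE ks).
  have := iX (k :: s) C'; rewrite /= ks us big_cons => /(_ isT) h.
  have mC' j : measurable (C' j) by rewrite /C'; case: ifP.
  have := iX s C us mC.
  rewrite -/(cyl C) => ->; move: (h mC'); have -> : X k @^-1` C' k = D by rewrite /C' eqxx.
  rewrite (eq_big_seq (fun j => P (X j @^-1` C j))); last by move=> j /C's ->.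
  move=> <-; congr (P _); rewrite setIC; apply/seteqP; split=> t /=.
    move=> [Dt Ct] j /=; rewrite inE => /orP[/eqP ->|js].
      by rewrite /C' eqxx.
    by rewrite C's//; exact: Ct.
  move=> Ct; split.
    by have := Ct k; rewrite /= mem_head /C' eqxx => /(_ isT).
  by move=> j /= js; have := Ct j; rewrite /= inE js orbT C's// => /(_ isT).
- move=> _; rewrite /mrestr; apply: le_lt_trans (ltry 1%R).
  exact: probability_le1 (measurableI _ _ _ _).
Qed.

End independence.

(** * Real integrals of bounded functions *)

Section bounded_expectation.
Context (d : measure_display) (T : measurableType d) (R : realType)
  (P : probability T R).

Lemma le_cst_integrable (f : T -> R) (c : R) :
  measurable_fun setT f -> (forall t, `|f t| <= c) ->
  P.-integrable setT (EFin \o f).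
Proof.
move=> mf fc; apply: (le_integrable measurableT _ _
  (finite_measure_integrable_cst P c measurableT)).
  exact/measurable_EFinP.
by move=> t _ /=; rewrite lee_fin (le_trans (fc t))// ler_norm.
Qed.

Lemma Rintegral_prob_cst (c : R) : \int[P]_t c = c.
Proof. by rewrite Rintegral_cst// [X in fine X](@probability_setT _ _ _ P) mulr1. Qed.

Lemma EFin_Rintegral (f : T -> R) : P.-integrable setT (EFin \o f) ->
  (\int[P]_t f t)%:E = (\int[P]_t (f t)%:E)%E.
Proof. by move=> fi; rewrite /Rintegral fineK//; exact: integrable_fin_num. Qed.

(** The nonnegative functions 1 + f and 1 + g fall under the Tonelli version; expanding both sides
    and cancelling 1 and the two single expectations leaves the product formula. *)
Lemma indep2_Rintegral (U V : T -> R) (f g : R -> R) :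
  measurable_fun setT U -> measurable_fun setT V -> indep2 P U V ->
  measurable_fun setT f -> measurable_fun setT g ->
  (forall x, `|f x| <= 1) -> (forall x, `|g x| <= 1) ->
  \int[P]_t (f (U t) * g (V t)) = (\int[P]_t f (U t)) * (\int[P]_t g (V t)).
Proof.
move=> mU mV UV mf mg f1 g1.
have mfU : measurable_fun setT (f \o U) by exact: measurableT_comp.
have mgV : measurable_fun setT (g \o V) by exact: measurableT_comp.
have f0 x : 0 <= 1 + f x by have := f1 x; rewrite ler_norml => /andP[]; lra.
have g0 x : 0 <= 1 + g x by have := g1 x; rewrite ler_norml => /andP[]; lra.
have b2 (x : R) : `|x| <= 1 -> `|1 + x| <= 2.
  by move=> x1; rewrite (le_trans (ler_normD _ _))// normr1; lra.
have i1 : P.-integrable setT (EFin \o cst (1:R)).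
  exact: finite_measure_integrable_cst.
have ifU : P.-integrable setT (EFin \o (fun t => f (U t))).
  exact: (@le_cst_integrable _ 1).
have igV : P.-integrable setT (EFin \o (fun t => g (V t))).
  exact: (@le_cst_integrable _ 1).
have ifg : P.-integrable setT (EFin \o (fun t => f (U t) * g (V t))).
  apply: (@le_cst_integrable _ 1); first exact: measurable_funM.
  by move=> t; rewrite normrM mulr_ile1.
have m1f : measurable_fun setT (fun t => 1 + f (U t)) by exact: measurable_funD.
have m1g : measurable_fun setT (fun t => 1 + g (V t)) by exact: measurable_funD.
have i1f : P.-integrable setT (EFin \o (fun t => 1 + f (U t))).
  by apply: (@le_cst_integrable _ 2) => // t; exact: b2.
have i1g : P.-integrable setT (EFin \o (fun t => 1 + g (V t))).
  by apply: (@le_cst_integrable _ 2) => // t; exact: b2.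
have h : \int[P]_t ((1 + f (U t)) * (1 + g (V t))) =
    (\int[P]_t (1 + f (U t))) * (\int[P]_t (1 + g (V t))).
  apply: EFin_inj; rewrite EFinM !EFin_Rintegral//; last first.
    apply: (@le_cst_integrable _ 4); first exact: measurable_funM.
    move=> t; rewrite normrM (_ : 4 = 2 * 2); last by ring.
    by apply: ler_pM => //; exact: b2.
  rewrite (@indep2_ge0_integral _ _ _ _ _ _
    (fun z => ((1 + f z.1) * (1 + g z.2))%:E) mU mV UV)/=; last 2 first.
    apply/measurable_EFinP/measurable_funM; apply: measurable_funD => //.
      exact: measurableT_comp.
    exact: measurableT_comp.
    by move=> z; rewrite lee_fin mulr_ge0.
  rewrite -ge0_integralZl//=; last 3 first.
    by apply/measurable_EFinP.
    by move=> t _; rewrite lee_fin.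
    by apply: integral_ge0 => t _; rewrite lee_fin.
  apply: eq_integral => t _; under eq_integral do rewrite EFinM.
  rewrite ge0_integralZr//=; first by apply/measurable_EFinP.
  - by move=> s _; rewrite lee_fin.
  - by rewrite lee_fin.
have e1 : \int[P]_t ((1 + f (U t)) * (1 + g (V t))) =
   1 + \int[P]_t f (U t) + (\int[P]_t g (V t) + \int[P]_t (f (U t) * g (V t))).
  transitivity (\int[P]_t ((1 + f (U t)) + (g (V t) + f (U t) * g (V t)))).
    by apply: eq_Rintegral => t _; ring.
  have igfg : P.-integrable setT
      (EFin \o (fun t => g (V t) + f (U t) * g (V t))).
    exact: (integrableD measurableT igV ifg).
  by rewrite (RintegralD measurableT i1f igfg) (RintegralD measurableT i1 ifU)
    (RintegralD measurableT igV ifg) Rintegral_prob_cst.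
move: h; rewrite e1 (RintegralD measurableT i1 ifU) (RintegralD measurableT i1 igV).
rewrite /= Rintegral_prob_cst.
move: (\int[P]_t f (U t)) (\int[P]_t g (V t)) (\int[P]_t (f (U t) * g (V t))).
by move=> a b c h; lra.
Qed.

Lemma density_integrable (D : set R) (Y : T -> R) (h : R -> R) :
  measurable D -> is_density P D Y h ->
  lebesgue_measure.-integrable D (EFin \o h).
Proof.
move=> mD [mh h0 hA]; apply/integrableP; split; first exact/measurable_EFinP.
under eq_integral => x /[!inE] Dx do rewrite /= ger0_norm ?h0//.
by have := hA setT measurableT; rewrite preimage_setT probability_setT setIT => <-;
  rewrite ltry.
Qed.

(** Again through 1 + F >= 0; the contributions of the constant 1 cancel because h has integral
    1. *)
Lemma Rintegral_density (D : set R) (Y : T -> R) (h F : R -> R) :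
  measurable D -> measurable_fun setT Y -> is_density P D Y h ->
  measurable_fun setT F -> (forall x, `|F x| <= 1) ->
  \int[P]_t F (Y t) = \int[lebesgue_measure]_(x in D) (F x * h x).
Proof.
move=> mD mY Yh mF F1; have ih := density_integrable mD Yh.
have [mh h0 hA] := Yh.
have F0 x : 0 <= 1 + F x by have := F1 x; rewrite ler_norml => /andP[]; lra.
have i1 : P.-integrable setT (EFin \o cst (1:R)).
  exact: finite_measure_integrable_cst.
have iF : P.-integrable setT (EFin \o (fun t => F (Y t))).
  apply: (@le_cst_integrable _ 1) => //; exact: measurableT_comp.
have iFh : lebesgue_measure.-integrable D (EFin \o (fun x => F x * h x)).
  apply: (@le_integrable _ _ _ lebesgue_measure D mD _ (EFin \o h)) => //.
    apply/measurable_EFinP/measurable_funM => //; exact: measurable_funTS.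
  by move=> x Dx /=; rewrite lee_fin normrM ler_piMl.
have h1 : \int[lebesgue_measure]_(x in D) h x = 1.
  have := hA setT measurableT; rewrite preimage_setT probability_setT setIT.
  by rewrite /Rintegral => <-.
have e : \int[P]_t (1 + F (Y t)) =
    \int[lebesgue_measure]_(x in D) (h x + F x * h x).
  congr fine; rewrite (ge0_integral_density mD mY Yh (F := fun x => (1 + F x)%:E)).
  - by apply: eq_integral => x _; rewrite -EFinM mulrDl mul1r.
  - by apply/measurable_EFinP; exact: measurable_funD.
  - by move=> x; rewrite lee_fin.
move: e; rewrite (RintegralD measurableT i1 iF) (@RintegralD _ _ _ lebesgue_measure D _ _ mD ih iFh) h1.
by rewrite /= Rintegral_prob_cst => /addrI.
Qed.

End bounded_expectation.

(** * Characters of the circle *)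

Section circle_characters.
Context (R : realType).
Implicit Types (k : int) (x y : R).

(** Together with [sinz], the real and imaginary parts of the character exp(2 pi i k x). Keeping
    them apart leaves every expectation real. *)
Definition cosz k x : R := cos (2 * pi * k%:~R * x).
Definition sinz k x : R := sin (2 * pi * k%:~R * x).

Lemma measurable_cosz k : measurable_fun setT (cosz k).
Proof.
apply: (measurableT_comp (continuous_measurable_fun (@continuous_cos R))).
exact: measurable_funM.
Qed.

Lemma measurable_sinz k : measurable_fun setT (sinz k).
Proof.
apply: (measurableT_comp (continuous_measurable_fun (@continuous_sin R))).
exact: measurable_funM.
Qed.

Lemma cosz_le1 k x : `|cosz k x| <= 1. Proof. exact: cos_max. Qed.

Lemma sinz_le1 k x : `|sinz k x| <= 1. Proof. exact: sin_max. Qed.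

Lemma coszD k x y : cosz k (x + y) = cosz k x * cosz k y - sinz k x * sinz k y.
Proof. by rewrite /cosz mulrDr cosD. Qed.

Lemma sinzD k x y : sinz k (x + y) = sinz k x * cosz k y + cosz k x * sinz k y.
Proof. by rewrite /sinz mulrDr sinD. Qed.

Lemma coszN k x : cosz k (- x) = cosz k x.
Proof. by rewrite /cosz mulrN cosN. Qed.

Lemma sinzN k x : sinz k (- x) = - sinz k x.
Proof. by rewrite /sinz mulrN sinN. Qed.

Lemma cosz_int k (j : int) : cosz k j%:~R = 1.
Proof.
rewrite /cosz -mulrA -intrM; move: (k * j) => m.
have E (n : nat) : 2 * pi * n%:R = 0 + pi *+ 2 *+ n :> R.
  by rewrite add0r mulr_natr mulr_natl.
case: (intP m) => [|n|n]; first by rewrite mulr0 cos0.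
  by rewrite -[_%:~R]/(n.+1%:R) E (periodicn (@cosD2pi R)) cos0.
by rewrite intrN mulrN cosN -[_%:~R]/(n.+1%:R) E (periodicn (@cosD2pi R)) cos0.
Qed.

Lemma sinz_int k (j : int) : sinz k j%:~R = 0.
Proof.
rewrite /sinz -mulrA -intrM; move: (k * j) => m.
have E (n : nat) : 2 * pi * n%:R = 0 + pi *+ 2 *+ n :> R.
  by rewrite add0r mulr_natr mulr_natl.
case: (intP m) => [|n|n]; first by rewrite mulr0 sin0.
  by rewrite -[_%:~R]/(n.+1%:R) E (periodicn (@sinD2pi R)) sin0.
by rewrite intrN mulrN sinN -[_%:~R]/(n.+1%:R) E (periodicn (@sinD2pi R)) sin0 oppr0.
Qed.

Lemma cosz_fracpart k x : cosz k (fracpart x) = cosz k x.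
Proof.
by have [j ->] := fracpartE x; rewrite coszD cosz_int sinz_int mulr1 mulr0 subr0.
Qed.

Lemma sinz_fracpart k x : sinz k (fracpart x) = sinz k x.
Proof.
by have [j ->] := fracpartE x; rewrite sinzD cosz_int sinz_int mulr1 mulr0 addr0.
Qed.

Lemma fourier_coefE (g : R -> R) (k : int) :
  lebesgue_measure.-integrable `[0, 1[ (EFin \o g) ->
  fourier_coef g k =
  (\int[lebesgue_measure]_(x in `[0, 1[) (cosz k x * g x)) +i*
  - (\int[lebesgue_measure]_(x in `[0, 1[) (sinz k x * g x)).
Proof.
move=> ig; rewrite /fourier_coef /cintegral; congr (_ +i* _).
  by apply: eq_Rintegral => x _; rewrite /= mul0r subr0 cosN mulrC.
rewrite -[RHS]mulN1r -(@RintegralZl _ _ _ lebesgue_measure `[0, 1[ _ (-1))//.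
  by apply: eq_Rintegral => x _; rewrite /= mul0r addr0 sinN mulrN -mulN1r (mulrC (g x)).
apply: (@le_integrable _ _ _ lebesgue_measure `[0, 1[ _ _ (EFin \o g)) => //.
  apply/measurable_EFinP/measurable_funM.
    by apply: measurable_funTS; exact: measurable_sinz.
  by apply/measurable_EFinP; exact: measurable_int ig.
by move=> x _ /=; rewrite lee_fin normrM ler_piMl// sinz_le1.
Qed.

End circle_characters.

(** * The logarithm of the mantissa as a fractional part *)

Section log_mantissa.
Context (R : realType) (B : R) (hB : 1 < B).

Lemma log_mantissaE (x : R) : log_mantissa B x = fracpart (logb B `|x|).
Proof.
have lnB : 0 < ln B by rewrite ln_gt0.
have B0 : 0 < B by apply: lt_trans hB.
(* At x = 0 both sides are 0, thanks to the convention ln 0 = 0. *)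
rewrite /log_mantissa; have [->|x0] := eqVneq x 0.
  by rewrite normr0 /mantissa mul0r /logb ln0// mul0r fracpart_id// lexx ltr01.
rewrite /mantissa /fracpart {1}/logb ln_div ?posrE ?normr_gt0 ?exprz_gt0//.
set k := Num.floor _; rewrite mulrBl -/(logb _ _) -powR_intmul ?(ltW B0)//.
by rewrite ln_powR mulfK// gt_eqF.
Qed.

Lemma logb_norm_prod (I : Type) (r : seq I) (x : I -> R) :
  (forall i, x i != 0) ->
  logb B `|\prod_(i <- r) x i| = \sum_(i <- r) logb B `|x i|.
Proof.
move=> x0; elim: r => [|i r IH]; first by rewrite !big_nil normr1 /logb ln1 mul0r.
rewrite !big_cons -IH normrM /logb lnM ?mulrDl ?posrE ?normr_gt0//.
by apply: (big_ind (fun y => y != 0)) => //; exact: mulf_neq0.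
Qed.

Lemma measurable_logb_norm : measurable_fun setT (fun x : R => logb B `|x|).
Proof.
apply: measurable_funM => //; apply: (measurableT_comp (@measurable_ln R)).
exact: normr_measurable.
Qed.

End log_mantissa.

(** * Logarithms of products *)

Section log_sums.
Context (d : measure_display) (T : measurableType d) (R : realType)
  (P : probability T R) (B : R) (X : nat -> {RV P >-> R}) (g : nat -> R -> R).
Hypotheses (hB : 1 < B) (hX_indep : independent_RVs X)
  (hX_cont : forall m, continuous_RV (X m))
  (hg : forall m,
    is_density P `[0, 1[ (fun t => log_mantissa B (X m t)) (g m)).

(** Indexed by a list because summands are split off at both ends: the last one in the induction for
    Fourier coefficients, the first one for smoothing. *)
Definition logsum (s : seq nat) (t : T) : R := \sum_(m <- s) logb B `|X m t|.

Lemma measurable_logsum s : measurable_fun setT (logsum s).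
Proof.
apply: measurable_sum => m.
exact: (measurableT_comp (measurable_logb_norm B)).
Qed.

Lemma measurable_logbX m : measurable_fun setT (fun t => logb B `|X m t|).
Proof. exact: (measurableT_comp (measurable_logb_norm B)). Qed.

Lemma indep2_logsum k s : uniq s -> k \notin s ->
  indep2 P (fun t => logb B `|X k t|) (logsum s).
Proof.
exact: (@indep2_sum _ _ _ _ X (fun x => logb B `|x|) _ _ hX_indep (measurable_logb_norm B)).
Qed.

Lemma density_fracpart_log m :
  is_density P `[0, 1[ (fun t => fracpart (logb B `|X m t|)) (g m).
Proof.
by have := hg m; congr is_density; apply/funext => t; rewrite log_mantissaE.
Qed.

(** A law with a density does not charge the point 0. This matters because ln 0 = 0 breaks the
    additivity of the logarithm as soon as a factor vanishes. *)
Lemma X_neq0_ae : {ae P, forall t, forall m, X m t != 0}.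
Proof.
apply/ae_foralln => m; exists (X m @^-1` [set 0]); split.
- exact: measurable_funPTI.
- have [f [_ _ hf]] := hX_cont m.
  by apply: etrans (hf _ (measurable_set1 0)) _; rewrite setTI integral_set1.
- by move=> t /= /negP; rewrite negbK => /eqP.
Qed.

Lemma log_mantissa_prod_ae M : {ae P, forall t,
  log_mantissa B (\prod_(m < M) X m t) = fracpart (logsum (iota 0 M) t)}.
Proof.
apply: filterS X_neq0_ae => t Xt; rewrite log_mantissaE//; congr fracpart.
by rewrite logb_norm_prod// /logsum -(big_mkord xpredT (fun m => logb B `|X m t|)) /index_iota subn0.
Qed.

(** Almost surely equal variables have the same law, and [is_density] depends on the variable only
    through its law. *)
Lemma is_density_prod M (D : set R) (h : R -> R) :
  is_density P D (fun t => log_mantissa B (\prod_(m < M) X m t)) h <->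
  is_density P D (fun t => fracpart (logsum (iota 0 M) t)) h.
Proof.
suff E A : measurable A -> P ((fun t => log_mantissa B (\prod_(m < M) X m t)) @^-1` A) =
    P ((fun t => fracpart (logsum (iota 0 M) t)) @^-1` A).
  by split=> -[mh h0 hA]; split=> // A mA; [rewrite -E// hA|rewrite E// hA].
move=> mA.
have mZ : measurable_fun setT (fun t => log_mantissa B (\prod_(m < M) X m t)).
  rewrite (_ : (fun t => _) =
    (fun t => fracpart (logb B `|\prod_(m < M) X m t|))); last first.
    by apply/funext => t; rewrite log_mantissaE.
  apply: (measurableT_comp (@measurable_fracpart R)).
  apply: (measurableT_comp (measurable_logb_norm B)).
  exact: measurable_prod.
have mS : measurable_fun setT (fun t => fracpart (logsum (iota 0 M) t)).
  apply: (measurableT_comp (@measurable_fracpart R)); exact: measurable_logsum.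
rewrite -[X in P X = _]setIT -[X in _ = P X]setIT -!integral_indic//; last 2 first.
  by rewrite -[X in measurable X]setTI; exact: mS.
  by rewrite -[X in measurable X]setTI; exact: mZ.
apply: ge0_ae_eq_integral => //.
- by apply/measurable_EFinP/measurable_indic; rewrite -[X in measurable X]setTI; exact: mZ.
- by apply/measurable_EFinP/measurable_indic; rewrite -[X in measurable X]setTI; exact: mS.
- by apply: filterS (log_mantissa_prod_ae M) => t E _; rewrite -[LHS]/((\1_A (log_mantissa B (\prod_(m < M) X m t)))%:E) E.
Qed.

(** The right-hand side is E exp(-2 pi i n S_M). In the induction, the addition formulas and
    independence reproduce the multiplication of complex numbers. *)
Lemma prod_fourier_coef (n : int) (M : nat) :
  \prod_(m < M) fourier_coef (g m) n =
  (\int[P]_t cosz n (logsum (iota 0 M) t)) +i*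
  - (\int[P]_t sinz n (logsum (iota 0 M) t)).
Proof.
elim: M => [|M IH].
  rewrite big_ord0 /logsum/=; under eq_Rintegral do rewrite big_nil -[0]/(0%:~R) cosz_int.
  under [X in _ +i* - X]eq_Rintegral do rewrite big_nil -[0]/(0%:~R) sinz_int.
  by rewrite !Rintegral_prob_cst oppr0.
rewrite big_ord_recr /= IH.
have iI : lebesgue_measure.-integrable `[0, 1[ (EFin \o g M).
  exact: density_integrable (density_fracpart_log M).
have mF := measurableT_comp (@measurable_fracpart R) (measurable_logbX M).
rewrite fourier_coefE//.
rewrite -(Rintegral_density _ mF (density_fracpart_log M) (measurable_cosz n) (cosz_le1 n))//.
rewrite -(Rintegral_density _ mF (density_fracpart_log M) (measurable_sinz n) (sinz_le1 n))//=.
have -> : \int[P]_t cosz n (fracpart (logb B `|X M t|)) =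
    \int[P]_t cosz n (logb B `|X M t|).
  by apply: eq_Rintegral => t _; rewrite cosz_fracpart.
have -> : \int[P]_t sinz n (fracpart (logb B `|X M t|)) =
    \int[P]_t sinz n (logb B `|X M t|).
  by apply: eq_Rintegral => t _; rewrite sinz_fracpart.
have SE t : logsum (iota 0 M.+1) t = logb B `|X M t| + logsum (iota 0 M) t.
  by rewrite -addn1 iotaD /logsum big_cat/= big_seq1 addrC add0n.
have I : indep2 P (fun t => logb B `|X M t|) (logsum (iota 0 M)).
  by apply: indep2_logsum; rewrite ?iota_uniq// mem_iota/= ltnn.
have mL := measurable_logbX M; have mS := measurable_logsum (iota 0 M).
have mul := @indep2_Rintegral _ _ _ P _ _ _ _ mL mS I.
have mc := measurable_cosz n; have ms := measurable_sinz n.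
have c1 := cosz_le1 n; have s1 := sinz_le1 n.
have ib (f1 f2 : R -> R) : measurable_fun setT f1 -> measurable_fun setT f2 ->
    (forall x, `|f1 x| <= 1) -> (forall x, `|f2 x| <= 1) ->
    P.-integrable setT
      (EFin \o (fun t => f1 (logb B `|X M t|) * f2 (logsum (iota 0 M) t))).
  move=> mf1 mf2 f11 f21; apply: (@le_cst_integrable _ _ _ _ _ 1).
    by apply: measurable_funM; exact: measurableT_comp.
  by move=> t; rewrite normrM mulr_ile1.
have -> : \int[P]_t cosz n (logsum (iota 0 M.+1) t) =
    \int[P]_t cosz n (logb B `|X M t|) * \int[P]_t cosz n (logsum (iota 0 M) t) -
    \int[P]_t sinz n (logb B `|X M t|) * \int[P]_t sinz n (logsum (iota 0 M) t).
  rewrite -!mul// -RintegralB ?ib//.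
  by apply: eq_Rintegral => t _; rewrite SE coszD.
have -> : \int[P]_t sinz n (logsum (iota 0 M.+1) t) =
    \int[P]_t sinz n (logb B `|X M t|) * \int[P]_t cosz n (logsum (iota 0 M) t) +
    \int[P]_t cosz n (logb B `|X M t|) * \int[P]_t sinz n (logsum (iota 0 M) t).
  rewrite -!mul// -RintegralD ?ib//.
  by apply: eq_Rintegral => t _; rewrite SE sinzD.
move: (\int[P]_t cosz n (logsum _ t)) (\int[P]_t sinz n (logsum _ t)).
move: (\int[P]_t cosz n (logb B _)) (\int[P]_t sinz n (logb B _)) => a b c e.
(* The product so far is c - i e and the new factor is a - i b. *)
rewrite -[LHS]/((c * a - (- e) * (- b)) +i* (c * (- b) + (- e) * a)).
by congr (_ +i* _); ring.
Qed.
End log_sums.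

(** * Trigonometric polynomial kernels *)

Section trigpoly.
Context (R : realType).

(** Cosines alone, so that kernels are even and K (x - u) has integral 1 in either variable. *)
Inductive trigpoly : (R -> R) -> Prop :=
| trigpoly_cos c k : trigpoly (fun x => c * cosz k x)
| trigpolyD K1 K2 : trigpoly K1 -> trigpoly K2 ->
    trigpoly (fun x => K1 x + K2 x).

Lemma trigpoly_measurable K : trigpoly K -> measurable_fun setT K.
Proof.
elim=> [c k|K1 K2 _ m1 _ m2]; last exact: measurable_funD.
by apply: measurable_funM => //; exact: measurable_cosz.
Qed.

Lemma trigpoly_bounded K : trigpoly K -> exists c, forall x, `|K x| <= c.
Proof.
elim=> [c k|K1 K2 _ [c1 b1] _ [c2 b2]].
  by exists `|c| => x; rewrite normrM ler_piMr// cosz_le1.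
by exists (c1 + c2) => x; rewrite (le_trans (ler_normD _ _))// lerD.
Qed.

Lemma trigpolyN K x : trigpoly K -> K (- x) = K x.
Proof. by elim=> [c k|K1 K2 _ -> _ ->//]; rewrite coszN. Qed.

Lemma trigpoly_fracpart K x : trigpoly K -> K (fracpart x) = K x.
Proof. by elim=> [c k|K1 K2 _ -> _ ->//]; rewrite cosz_fracpart. Qed.

Lemma trigpoly_period K x (j : int) : trigpoly K -> K (x + j%:~R) = K x.
Proof. by move=> tK; rewrite -trigpoly_fracpart// fracpartDz trigpoly_fracpart. Qed.

Lemma trigpolyZ K a : trigpoly K -> trigpoly (fun x => a * K x).
Proof.
elim=> [c k|K1 K2 _ t1 _ t2].
  rewrite (_ : (fun x => _) = (fun x => (a * c) * cosz k x)).
    exact: trigpoly_cos.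
  by apply/funext => x; rewrite mulrA.
rewrite (_ : (fun x => _) = (fun x => a * K1 x + a * K2 x)).
  exact: trigpolyD.
by apply/funext => x; rewrite mulrDr.
Qed.

(** Product-to-sum formula: a multiplication by [cosz 1] shifts the frequency k to k + 1 and k -
    1. *)
Lemma trigpolyM_cosz K : trigpoly K -> trigpoly (fun x => cosz 1 x * K x).
Proof.
elim=> [c k|K1 K2 _ t1 _ t2].
  rewrite (_ : (fun x => _) =
      (fun x => (c / 2) * cosz (k + 1) x + (c / 2) * cosz (k - 1) x)).
    by apply: trigpolyD; exact: trigpoly_cos.
  apply/funext => x; rewrite /cosz.
  rewrite (_ : 2 * pi * (k + 1)%:~R * x =
    2 * pi * k%:~R * x + 2 * pi * 1%:~R * x); last by rewrite intrD; ring.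
  rewrite (_ : 2 * pi * (k - 1)%:~R * x =
    2 * pi * k%:~R * x - 2 * pi * 1%:~R * x); last by rewrite intrB; ring.
  by rewrite cosD cosB; field.
rewrite (_ : (fun x => _) = (fun x => cosz 1 x * K1 x + cosz 1 x * K2 x)).
  exact: trigpolyD.
by apply/funext => x; rewrite mulrDr.
Qed.

(** It takes values in [0, 1] and reaches 1 exactly at the integers, so its normalised powers form a
    nonnegative approximate unit. *)
Definition bump (x : R) : R := (1 + cosz 1 x) / 2.

Lemma trigpoly_bump N : trigpoly (fun x => bump x ^+ N).
Proof.
elim: N => [|N IH].
  rewrite (_ : (fun x => _) = (fun x => 1 * cosz 0 x)); first exact: trigpoly_cos.
  by apply/funext => x; rewrite expr0 /cosz mulr0 mul0r cos0 mulr1.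
rewrite (_ : (fun x => _) = (fun x =>
    2^-1 * bump x ^+ N + 2^-1 * (cosz 1 x * bump x ^+ N))); last first.
  by apply/funext => x; rewrite exprS {1}/bump; field.
by apply: trigpolyD; apply: trigpolyZ => //; exact: trigpolyM_cosz.
Qed.

Lemma bump_itv x : 0 <= bump x <= 1.
Proof.
have := cosz_le1 1 x; rewrite ler_norml /bump => /andP[a b].
by rewrite divr_ge0 ?ler_pdivrMr//; lra.
Qed.

Lemma bump_nonincreasing x y : 0 <= x -> x <= y -> y <= 2^-1 -> bump y <= bump x.
Proof.
move=> x0 xy y2; rewrite /bump ler_pM2r ?invr_gt0// lerD2l /cosz.
have p0 := @pi_gt0 R.
rewrite leNgt; apply/negP; rewrite ltr_cos ?in_itv/=; first nra.
all: apply/andP; split; nra.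
Qed.

Lemma bump_decreasing x y : 0 <= x -> x < y -> y <= 2^-1 -> bump y < bump x.
Proof.
move=> x0 xy y2; rewrite /bump ltr_pM2r ?invr_gt0// ltrD2l /cosz.
have p0 := @pi_gt0 R.
rewrite ltr_cos ?in_itv/=; first nra.
all: apply/andP; split; nra.
Qed.

(** By parity and periodicity, |x| > 1/2 may be replaced by 1 - |x|, which brings the point into
    [e, 1/2], where [bump] decreases. *)
Lemma bump_off (e x : R) : 0 < e -> e <= `|x| -> `|x| <= 1 - e -> bump x <= bump e.
Proof.
move=> e0; have bumpN y : bump (- y) = bump y by rewrite /bump coszN.
have -> : bump x = bump `|x|.
  by case: (ger0P x) => //; rewrite bumpN.
move: `|x| => {}x ex xe; have [x2|x2] := leP x 2^-1.
  by apply: bump_nonincreasing => //; exact: ltW.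
have -> : bump x = bump (1 - x).
  by rewrite -[RHS]bumpN opprB /bump coszD -[-1]/((-1)%:~R) cosz_int sinz_int mulr1 mulr0 subr0.
apply: bump_nonincreasing; first exact: ltW; lra.
Qed.

(* K is the normalised power of bump x = cos (pi x) ^+ 2: away from the integers
   that power is at most r ^+ N, and its integral is at least e / 2 * s ^+ N,
   with r < s. *)
Lemma exists_trigpoly_kernel (e eta : R) : 0 < e -> e <= 2^-1 -> 0 < eta ->
  exists K, [/\ trigpoly K, forall x, 0 <= K x, \int[unif R]_x K x = 1 &
    forall x, e <= `|x| -> `|x| <= 1 - e -> K x <= eta].
Proof.
move=> e0 e2 eta0; pose r := bump e; pose s := bump (e / 2).
have rs : r < s by apply: bump_decreasing => //; lra.
have r0 : 0 <= r by have /andP[] := bump_itv e.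
have s0 : 0 < s by exact: le_lt_trans rs.
(* The normalised kernel is at most r^N / c for e <= |x| <= 1 - e, and c >= (e / 2) s^N; this choice
   of N makes the quotient at most eta. *)
have [N hN] : exists N, (r / s) ^+ N <= eta * (e / 2).
  have rs1 : `|r / s| < 1.
    have rs0 : 0 <= r / s by rewrite divr_ge0// ltW.
    by rewrite ger0_norm// ltr_pdivrMr// mul1r.
  have /cvgrPdist_le/(_ (eta * (e / 2))) := cvg_expr rs1.
  move=> /(_ _)[|N _ /(_ N (leqnn N))]; first by rewrite mulr_gt0// divr_gt0.
  by rewrite sub0r normrN => h; exists N; rewrite (le_trans _ h)// ler_norm.
have tb := trigpoly_bump N; have mb := trigpoly_measurable tb.
have b0 x : 0 <= bump x ^+ N by rewrite exprn_ge0//; have /andP[] := bump_itv x.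
have ib : (unif R).-integrable setT (EFin \o (fun x => bump x ^+ N)).
  apply: (@le_cst_integrable _ _ _ _ _ 1) => // x.
  by rewrite ger0_norm// exprn_ile1//; have /andP[] := bump_itv x.
pose c := \int[unif R]_x (bump x ^+ N).
have cE : e / 2 * s ^+ N <= c.
  rewrite -lee_fin EFin_Rintegral// integral_unif//; last exact/measurable_EFinP.
  apply: (@le_trans _ _
    (\int[lebesgue_measure]_(x in `[0%R, (e / 2)%R[) (bump x ^+ N)%:E)%E); last first.
    apply: ge0_subset_integral => //=.
      by apply/measurable_funTS/measurable_EFinP.
      by move=> x _; rewrite lee_fin.
    by move=> x /=; rewrite !in_itv/= => /andP[-> xe]; rewrite (lt_trans xe)//; lra.
  have -> : (e / 2 * s ^+ N)%:E =
      (\int[lebesgue_measure]_(x in `[0%R, (e / 2)%R[) (s ^+ N)%:E)%E.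
    rewrite integral_cst//= lebesgue_measure_itv/= lte_fin ifT ?divr_gt0//.
    by rewrite oppr0 adde0 -EFinM mulrC.
  apply: ge0_le_integral => //=.
  - by move=> x _; rewrite lee_fin exprn_ge0// ltW.
  - by apply/measurable_funTS/measurable_EFinP.
  - move=> x; rewrite in_itv/= lee_fin => /andP[x0 xe].
    by apply: lerXn2r; rewrite ?nnegrE ?(ltW s0)//;
      [have /andP[] := bump_itv x|apply: bump_nonincreasing; lra].
have c0 : 0 < c by apply: lt_le_trans cE; rewrite mulr_gt0 ?divr_gt0// exprn_gt0.
exists (fun x => c^-1 * bump x ^+ N); split.
- exact: trigpolyZ.
- by move=> x; rewrite mulr_ge0// invr_ge0 ltW.
- by rewrite RintegralZl// mulVf// gt_eqF.
- move=> x ex xe; rewrite mulrC ler_pdivrMr//.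
  apply: (@le_trans _ _ (r ^+ N)).
    apply: lerXn2r; rewrite ?nnegrE//; first by have /andP[] := bump_itv x.
    exact: bump_off.
  apply: (@le_trans _ _ (eta * (e / 2 * s ^+ N))); last by rewrite ler_pM2l.
  by rewrite mulrA -ler_pdivrMr ?exprn_gt0// -expr_div_n.
Qed.

End trigpoly.

(** * Uniform continuity and boundedness on a segment *)

Lemma continuous_unif_segment (R : realType) (f : R -> R) (a b e : R) :
  continuous f -> 0 < e -> exists2 del : R, 0 < del &
    forall x y, a <= x <= b -> `|x - y| < del -> `|f x - f y| <= e.
Proof.
move=> cf e0; pose P (del x : R) := forall y, `|x - y| < del -> `|f x - f y| <= e.
have : \forall del \near 0^'+, `[a, b] `<=` P del.
  have /compact_near_coveringP := @segment_compact R a b.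
  move=> /(_ R (0^'+) P); apply => x _.
  have /cvgrPdist_le/(_ (e / 2)) := cf x.
  move=> /(_ _)[|r /= r0 hr]; first by rewrite divr_gt0.
  (* A point x' within r / 2 of x and a point y within del < r / 2 of x' both lie within r of x,
     where f stays within e / 2 of f x. *)
  exists (ball x (r / 2), [set del | 0 < del < r / 2]) => /=.
    split; first by apply: nbhsx_ballx; rewrite divr_gt0.
    near=> del; apply/andP; split; first by near: del; exact: nbhs_right_gt.
    by near: del; apply: nbhs_right_lt; rewrite divr_gt0.
  move=> [x' del] /= [xx' /andP[d0 dr]] y x'y.
  have h1 : `|f x - f x'| <= e / 2.
    by apply: hr => /=; move: xx'; rewrite /ball/=; lra.
  have h2 : `|f x - f y| <= e / 2.
    apply: hr => /=; rewrite (_ : x - y = (x - x') + (x' - y)); last by ring.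
    by rewrite (le_lt_trans (ler_normD _ _))//; move: xx'; rewrite /ball/=; lra.
  rewrite (_ : f x' - f y = (f x - f y) - (f x - f x')); last by ring.
  by rewrite (le_trans (ler_normB _ _))//; lra.
move=> [r /= r0 hr]; exists (r / 2); first by rewrite divr_gt0.
move=> x y xab xy; apply: (hr (r / 2)) => //=.
  by rewrite sub0r normrN gtr0_norm ?divr_gt0//; lra.
  by rewrite divr_gt0.
Unshelve. all: by end_near. Qed.

(** Asking for C >= 1 allows later tolerances to be divided by C. *)
Lemma continuous_bounded_segment (R : realType) (f : R -> R) (a b : R) :
  continuous f -> exists2 C : R, 1 <= C & forall x, a <= x <= b -> `|f x| <= C.
Proof.
move=> cf.
have /compact_bounded[M [_ hM]] : compact (f @` `[a, b]).
  by apply: continuous_compact; [exact: continuous_subspaceT|exact: segment_compact].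
exists (Num.max 1 (M + 1)); first by rewrite le_max lexx.
move=> x xab; rewrite (le_trans (hM (M + 1) _ (f x) _)) ?ltrDl//.
by rewrite le_max lexx orbT.
Qed.

(** * Expectations of trigonometric polynomials *)

Section kernel.
Context (R : realType).

(** Rotation by v preserves the integral and changes its sign; rotation invariance is applied to 1 +
    f, which is nonnegative. *)
Lemma Rintegral_unif_alternating (f : R -> R) (v : R) :
  measurable_fun setT f -> (forall x, `|f x| <= 1) ->
  (forall x, f (fracpart x) = f x) -> (forall x, f (x + v) = - f x) ->
  \int[unif R]_x f x = 0.
Proof.
move=> mf f1 fE fv.
have i1 : (unif R).-integrable setT (EFin \o cst (1:R)).
  exact: finite_measure_integrable_cst.
have if_ : (unif R).-integrable setT (EFin \o f).
  exact: (@le_cst_integrable _ _ _ _ _ 1).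
have h := @ge0_integral_unif_rot R (fun x => (1 + f x)%:E) v.
have m1f : measurable_fun [set: R] (fun x : R => (1 + f x)%:E).
  by apply/measurable_EFinP; exact: measurable_funD.
have f0 (x : R) : (0%R <= (1 + f x)%:E)%E.
  by rewrite lee_fin; have := f1 x; rewrite ler_norml => /andP[]; lra.
have : \int[unif R]_x (1 - f x) = \int[unif R]_x (1 + f x).
  move: (h m1f f0); under eq_integral do rewrite fE fv.
  by under [in X in _ = X -> _]eq_integral do rewrite fE; rewrite /Rintegral => ->.
rewrite (RintegralD measurableT i1 if_) (RintegralB measurableT i1 if_); lra.
Qed.

Lemma Rintegral_unif_cosz (k : int) : k != 0 -> \int[unif R]_x cosz k x = 0.
Proof.
(* Half a period: this shift adds pi to the phase. *)
move=> k0; apply: (@Rintegral_unif_alternating _ (2 * k%:~R)^-1).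
- exact: measurable_cosz.
- by move=> x; exact: cosz_le1.
- by move=> x; exact: cosz_fracpart.
- move=> x; rewrite /cosz mulrDr.
  have -> : 2 * pi * k%:~R * (2 * k%:~R)^-1 = pi :> R by field; rewrite intr_eq0.
  exact: cosDpi.
Qed.

Lemma Rintegral_unif_sinz (k : int) : k != 0 -> \int[unif R]_x sinz k x = 0.
Proof.
move=> k0; apply: (@Rintegral_unif_alternating _ (2 * k%:~R)^-1).
- exact: measurable_sinz.
- by move=> x; exact: sinz_le1.
- by move=> x; exact: sinz_fracpart.
- move=> x; rewrite /sinz mulrDr.
  have -> : 2 * pi * k%:~R * (2 * k%:~R)^-1 = pi :> R by field; rewrite intr_eq0.
  exact: sinDpi.
Qed.

(** Expanding [cosz k (x - S M t)] leaves x only in factors bounded by 1, which gives uniformity in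
    x. Frequency 0 contributes the same constant to both integrals. *)
Lemma trigpoly_expectation (d : measure_display) (T : measurableType d)
    (P : probability T R) (S : nat -> T -> R) (K : R -> R) (eta : R) :
  (forall M, measurable_fun setT (S M)) ->
  (forall k : int, k != 0 ->
    \int[P]_t cosz k (S M t) @[M --> \oo] --> (0 : R)) ->
  (forall k : int, k != 0 ->
    \int[P]_t sinz k (S M t) @[M --> \oo] --> (0 : R)) ->
  trigpoly K -> 0 < eta ->
  \forall M \near \oo, forall x,
    `|\int[P]_t K (x - S M t) - \int[unif R]_x K x| <= eta.
Proof.
move=> mS hc hs tK; elim: tK eta => [c k|K1 K2 t1 IH1 t2 IH2] eta eta0.
  have [->|k0] := eqVneq k 0.
    near=> M => x.
    have cz y : c * cosz 0 y = c :> R by rewrite /cosz mulr0 mul0r cos0 mulr1.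
    under eq_Rintegral do rewrite cz.
    under [X in _ - X]eq_Rintegral do rewrite cz.
    by rewrite !Rintegral_prob_cst subrr normr0 ltW.
  have ic M : P.-integrable setT (EFin \o (fun t => cosz k (S M t))).
    apply: (@le_cst_integrable _ _ _ _ _ 1); last by move=> t; exact: cosz_le1.
    exact: measurableT_comp (@measurable_cosz R k) (mS M).
  have is_ M : P.-integrable setT (EFin \o (fun t => sinz k (S M t))).
    apply: (@le_cst_integrable _ _ _ _ _ 1); last by move=> t; exact: sinz_le1.
    exact: measurableT_comp (@measurable_sinz R k) (mS M).
  (* Adding 1 permits the division when c = 0. *)
  pose c' := `|c| + 1; have c'0 : 0 < c' by rewrite ltr_wpDl.
  have e0 : 0 < eta / c' / 2 by rewrite !divr_gt0.
  have /cvgrPdist_le/(_ _ e0) Hc := hc k k0.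
  have /cvgrPdist_le/(_ _ e0) Hs := hs k k0.
  near=> M => x.
  rewrite [X in _ - X]RintegralZl//; last first.
    apply: (@le_cst_integrable _ _ _ _ _ 1); last by move=> t; exact: cosz_le1.
    exact: (@measurable_cosz R k).
  rewrite Rintegral_unif_cosz// mulr0 subr0.
  have -> : \int[P]_t (c * cosz k (x - S M t)) =
      c * (cosz k x * \int[P]_t cosz k (S M t) + sinz k x * \int[P]_t sinz k (S M t)).
    have izc : P.-integrable setT (EFin \o (fun t => cosz k x * cosz k (S M t))).
      exact: (@integrableZl _ _ _ P setT measurableT (cosz k x) _ (ic M)).
    have izs : P.-integrable setT (EFin \o (fun t => sinz k x * sinz k (S M t))).
      exact: (@integrableZl _ _ _ P setT measurableT (sinz k x) _ (is_ M)).
    rewrite -!RintegralZl// -RintegralD// -RintegralZl//; last exact: (@integrableD _ _ _ P setT measurableT _ _ izc izs).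
    by apply: eq_Rintegral => t _; rewrite coszD coszN sinzN mulrN opprK.
  have h1 : `|\int[P]_t cosz k (S M t)| <= eta / c' / 2.
    by rewrite -normrN -sub0r; near: M.
  have h2 : `|\int[P]_t sinz k (S M t)| <= eta / c' / 2.
    by rewrite -normrN -sub0r; near: M.
  rewrite normrM (le_trans (ler_wpM2l (normr_ge0 c) (ler_normD _ _)))// !normrM.
  have h3 : `|cosz k x| * `|\int[P]_t cosz k (S M t)| <= eta / c' / 2.
    by rewrite (le_trans _ h1)// ler_piMl// cosz_le1.
  have h4 : `|sinz k x| * `|\int[P]_t sinz k (S M t)| <= eta / c' / 2.
    by rewrite (le_trans _ h2)// ler_piMl// sinz_le1.
  apply: (@le_trans _ _ (c' * (eta / c'))); last by rewrite mulrC divfK// gt_eqF.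
  apply: ler_pM; [by []|by apply: addr_ge0; apply: mulr_ge0| |].
    by rewrite lerDl.
  by move: h3 h4; move: (eta / c') => z; lra.
have e0 : 0 < eta / 2 by rewrite divr_gt0.
have iT K0 M x : trigpoly K0 -> P.-integrable setT (EFin \o (fun t => K0 (x - S M t))).
  move=> tK0; have [b hb] := trigpoly_bounded tK0.
  apply: (@le_cst_integrable _ _ _ _ _ b) => //.
  apply: (measurableT_comp (trigpoly_measurable tK0)).
  exact: measurable_funB.
have iU K0 : trigpoly K0 -> (unif R).-integrable setT (EFin \o K0).
  move=> tK0; have [b hb] := trigpoly_bounded tK0.
  by apply: (@le_cst_integrable _ _ _ _ _ b) => //; exact: trigpoly_measurable.
near=> M.
have h1 : forall x, `|\int[P]_t K1 (x - S M t) - \int[unif R]_x K1 x| <= eta / 2.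
  by near: M; exact: IH1 e0.
have h2 : forall x, `|\int[P]_t K2 (x - S M t) - \int[unif R]_x K2 x| <= eta / 2.
  by near: M; exact: IH2 e0.
move=> x.
rewrite (RintegralD measurableT (iT _ M x t1) (iT _ M x t2)).
rewrite (RintegralD measurableT (iU _ t1) (iU _ t2)).
rewrite opprD addrACA (le_trans (ler_normD _ _))//.
by rewrite (splitr eta) lerD.
Unshelve. all: by end_near. Qed.

End kernel.

(** * Approximation by kernels in mean *)

Section kernel_approximation.
Context (R : realType).
Local Notation lam := (unif R).

Lemma integral_kernel (K : R -> R) (x : R) : trigpoly K ->
  (forall y, 0 <= K y) -> \int[lam]_y K y = 1 ->
  (\int[lam]_u (K (u - x))%:E = 1)%E.
Proof.
move=> tK K0 K1.
have mK : measurable_fun [set: R] (EFin \o K).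
  by apply/measurable_EFinP; exact: trigpoly_measurable.
have KE0 (y : R) : (0 <= (EFin \o K) y)%E by rewrite lee_fin.
have [b hb] := trigpoly_bounded tK.
transitivity (\int[lam]_u (EFin \o K) (fracpart (u - x)%R))%E.
  by apply: eq_integral => u _ /=; rewrite trigpoly_fracpart.
rewrite ge0_integral_unif_rot//.
transitivity (\int[lam]_u (K u)%:E)%E.
  by apply: eq_integral => u _ /=; rewrite trigpoly_fracpart.
rewrite -EFin_Rintegral ?K1//; apply: (@le_cst_integrable _ _ _ _ _ b) => //.
exact: trigpoly_measurable.
Qed.

Lemma integral_kernelN (K : R -> R) (x : R) : trigpoly K ->
  (forall y, 0 <= K y) -> \int[lam]_y K y = 1 ->
  (\int[lam]_u (K (x - u))%:E = 1)%E.
Proof.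
move=> tK K0 K1; rewrite -(integral_kernel x tK K0 K1).
by apply: eq_integral => u _; rewrite -opprB (trigpolyN _ tK).
Qed.

Lemma trigpoly_measurableB (K : R -> R) : trigpoly K ->
  measurable_fun setT (fun z : R * R => K (z.1 - z.2)).
Proof.
move=> tK; apply: (measurableT_comp (trigpoly_measurable tK)).
exact: (measurable_funB measurable_fst measurable_snd).
Qed.

Lemma integral_unif_indic_fracpart (a b : R) : a <= b ->
  (\int[lam]_x (\1_`[a, b] (fracpart x))%:E <= (b - a)%:E)%E.
Proof.
move=> ab; rewrite integral_unif//; last first.
  apply/measurable_EFinP; apply: (measurableT_comp _ (@measurable_fracpart R)).
  exact: measurable_indic.
have -> : (\int[lebesgue_measure]_(x in `[0%R, 1%R[)
    (\1_`[a, b] (fracpart x))%:E = \int[lebesgue_measure]_(x in `[0%R, 1%R[)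
    (\1_`[a, b] x)%:E)%E.
  apply: eq_integral => x; rewrite inE/= in_itv/= => x01.
  by rewrite fracpart_id.
rewrite integral_indic//=.
apply: (@le_trans _ _ (lebesgue_measure `[a, b])); first exact: measureIl.
by rewrite lebesgue_measure_itv/= lte_fin; case: ltP => // _; rewrite lee_fin subr_ge0.
Qed.

(** Continuous functions are dense in L^1 of the segment. The values of phi at 0 and 1 may differ,
    so [phi (fracpart x)] can jump at the integers; [kernel_approx] has to absorb that jump. *)
Lemma continuous_approx_unif (G : R -> R) (e : R) :
  measurable_fun setT G -> lam.-integrable setT (EFin \o G) -> 0 < e ->
  exists2 phi : R -> R, continuous phi &
    (\int[lam]_x `|G x - phi (fracpart x)|%:E <= e%:E)%E.
Proof.
move=> mG iG e0.
have iG' : lebesgue_measure.-integrable `[0, 1]%classic (EFin \o G).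
  apply/integrableP; split; first exact/measurable_funTS/measurable_EFinP.
  have /integrableP[_] := iG; rewrite integral_uniform ?subr0 ?invr1 ?mul1e//.
  by apply/measurableT_comp => //; exact/measurable_EFinP.
have I01 : (lebesgue_measure (`[0%R, 1%R]%classic : set R) < +oo)%E.
  by rewrite lebesgue_measure_itv/= lte_fin ltr01 oppr0 adde0 ltry.
have [//|phi [cphi iphi hphi]] := approximation_continuous_integrable _ I01 iG'.
have /fine_cvgP[hfin /cvgrPdist_lt/(_ e e0) hlt] := hphi.
have [N _ /(_ N (leqnn N))[/= Nfin Nlt]] := filterI hfin hlt.
exists (phi N); first exact: cphi.
have mphi : measurable_fun [set: R] (phi N) by exact: continuous_measurable_fun.
have mphif : measurable_fun [set: R] (fun x => phi N (fracpart x)).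
  exact: (measurableT_comp mphi (@measurable_fracpart R)).
rewrite integral_unif//; last first.
  apply/measurable_EFinP; apply: (measurableT_comp (@normr_measurable R setT)).
  exact: measurable_funB.
have -> : (\int[lebesgue_measure]_(x in `[0%R, 1%R[) `|G x - phi N (fracpart x)|%:E =
    \int[lebesgue_measure]_(x in `[0%R, 1%R[) `|G x - phi N x|%:E)%E.
  by apply: eq_integral => x; rewrite inE/= in_itv/= => x01; rewrite fracpart_id.
have mGphi : measurable_fun [set: R] (fun x => `|G x - phi N x|%:E).
  apply/measurable_EFinP; apply: (measurableT_comp (@normr_measurable R setT)).
  exact: measurable_funB.
rewrite integral_itv_bndo_bndc; last exact: measurable_funTS.
move: Nlt; rewrite sub0r normrN => /ltW; rewrite -lee_fin; apply: le_trans.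
by rewrite -[leLHS]fineK// lee_fin ler_norm.
Qed.

(** The triangle inequality through phi bounds |G x - G u| by a x + |phi x' - phi u'| + a u. The two
    outer terms cost eps / 8 each, since K has integral 1 in both variables; the middle one is
    treated according to |x' - u'|. *)
Lemma kernel_approx (G : R -> R) (eps : R) :
  measurable_fun setT G -> lam.-integrable setT (EFin \o G) -> 0 < eps ->
  exists K, [/\ trigpoly K, forall x, 0 <= K x, \int[lam]_x K x = 1 &
    (\int[lam]_x \int[lam]_u (K (x - u) * `|G x - G u|)%:E <= eps%:E)%E].
Proof.
move=> mG iG eps0.
have e8 : 0 < eps / 8 by rewrite divr_gt0.
have [phi cphi hphi] := continuous_approx_unif mG iG e8.
have [C C1 hC] := continuous_bounded_segment 0 1 cphi.
have C0 : 0 < C by exact: lt_le_trans C1.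
have [del0 del00 hdel0] := continuous_unif_segment 0 1 cphi e8.
have dC0 : 0 < eps / (16 * C) by rewrite divr_gt0// mulr_gt0.
(* The bound eps / (16 C) makes the jump term 2 C (del + del) at most eps / 4. With eps / 4 from the
   far range and eps / 8 from uniform continuity, the total is 7 eps / 8. *)
pose del := Num.min (Num.min del0 2^-1) (eps / (16 * C)).
have del_gt0 : 0 < del by rewrite !lt_min del00 dC0 invr_gt0 ltr0n.
have del_le0 : del <= del0 by rewrite !ge_min lexx.
have del_le2 : del <= 2^-1 by rewrite !ge_min lexx orbT.
have del_leC : del <= eps / (16 * C) by rewrite !ge_min lexx !orbT.
have eta0 : 0 < eps / (8 * C) by rewrite divr_gt0// mulr_gt0.
have [K [tK K0 K1 Koff]] := exists_trigpoly_kernel del_gt0 del_le2 eta0.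
exists K; split=> //.
pose a (x : R) : R := `|G x - phi (fracpart x)|.
(* Marks the layers of width del on both sides of the integers, where phi may jump. *)
pose b (x : R) : R := \1_`[0, del] (fracpart x) + \1_`[1 - del, 1] (fracpart x).
have a0 x : 0 <= a x by exact: normr_ge0.
have b0 x : 0 <= b x by rewrite /b addr_ge0 ?indicE.
have pointwise x u : K (x - u) * `|G x - G u| <=
    K (x - u) * (a x + eps / 8 + 2 * C * b x) + (eps / 4 + K (x - u) * a u).
  set x' := fracpart x; set u' := fracpart u.
  have -> : K (x - u) = K (x' - u').
    rewrite /x' /u' /fracpart opprB addrACA -(trigpoly_period _ (Num.floor u - Num.floor x) tK).
    by rewrite intrB [in LHS]addrA; congr K; ring.
  have [x0 x1 u0 u1] : [/\ 0 <= x', x' < 1, 0 <= u' & u' < 1].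
    by rewrite !fracpart_ge0 !fracpart_lt1.
  have hphiC : `|phi x' - phi u'| <= 2 * C.
    rewrite (le_trans (ler_normB _ _))// mulr_natl mulr2n lerD// hC//.
      by rewrite x0 ltW.
    by rewrite u0 ltW.
  have tri : `|G x - G u| <= a x + `|phi x' - phi u'| + a u.
    rewrite /a -/x' -/u' (_ : G x - G u =
      (G x - phi x') + (phi x' - phi u') - (G u - phi u')); last by ring.
    by rewrite (le_trans (ler_normB _ _))// lerD2r ler_normD.
  have Kx0 := K0 (x' - u').
  have bx0 : 0 <= 2 * C * b x by rewrite mulr_ge0// mulr_ge0// ltW.
  suff main : K (x' - u') * `|phi x' - phi u'| <=
      K (x' - u') * (eps / 8 + 2 * C * b x) + eps / 4.
    by move: (ler_wpM2l Kx0 tri); rewrite !mulrDr; move: main; rewrite !mulrDr; lra.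
  (* Close fractional parts: uniform continuity of phi gives eps / 8. *)
  have [h1|h1] := ltP `|x' - u'| del.
    apply: (@le_trans _ _ (K (x' - u') * (eps / 8 + 2 * C * b x))).
      apply: ler_wpM2l => //; apply: (@le_trans _ _ (eps / 8)); last by rewrite lerDl.
      by apply: hdel0; [rewrite x0 ltW|exact: lt_le_trans del_le0].
    by rewrite lerDl; lra.
  (* Points far apart on the circle: K is at most eps / (8 C) and phi varies by at most 2 C. *)
  have [h2|h2] := leP `|x' - u'| (1 - del).
    apply: (@le_trans _ _ (eps / 4)); last first.
      by rewrite lerDr mulr_ge0// addr_ge0// ltW.
    apply: (@le_trans _ _ (eps / (8 * C) * (2 * C))).
      by apply: ler_pM => //; exact: Koff.
    by rewrite le_eqVlt; apply/orP; left; apply/eqP; field; rewrite gt_eqF.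
  (* Here x' and u' sit near opposite ends of the unit interval, hence close on the circle: K is not
     small, but x' lies in a marked layer. *)
  have bx1 : 1 <= b x.
    rewrite /b !indicE -/x'; have [xu|xu] := leP u' x'.
      have -> : x' \in `[1 - del, 1]%classic; last by rewrite lerDr.
      apply: mem_set; rewrite /= in_itv/= (ltW x1) andbT.
      by move: h2; rewrite ger0_norm ?subr_ge0//; lra.
    have -> : x' \in `[0, del]%classic; last by rewrite lerDl.
    apply: mem_set; rewrite /= in_itv/= x0.
    by move: h2; rewrite ltr0_norm ?subr_lt0//; lra.
  apply: (@le_trans _ _ (K (x' - u') * (eps / 8 + 2 * C * b x))).
    apply: ler_wpM2l => //; rewrite (le_trans hphiC)//.
    apply: (@le_trans _ _ (2 * C * b x)); last by rewrite lerDr ltW.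
    by rewrite ler_peMr// mulr_ge0// ltW.
  by rewrite lerDl; lra.
have mK := trigpoly_measurableB tK.
have mphif : measurable_fun [set: R] (fun x => phi (fracpart x)).
  exact: (measurableT_comp (continuous_measurable_fun cphi) (@measurable_fracpart R)).
have ma : measurable_fun [set: R] a.
  apply: (measurableT_comp (@normr_measurable R setT)); exact: measurable_funB.
have mi (c d : R) : measurable_fun [set: R] (fun x : R => \1_`[c, d] (fracpart x) : R).
  apply: (measurableT_comp _ (@measurable_fracpart R)); exact: measurable_indic.
have mb : measurable_fun [set: R] b by exact: measurable_funD.
have mKx x : measurable_fun [set: R] (fun u => K (x - u)).
  apply: (measurableT_comp (trigpoly_measurable tK)); exact: measurable_funB.
have mKxE x : measurable_fun [set: R] (fun u => (K (x - u))%:E).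
  exact/measurable_EFinP.
have mbE : measurable_fun [set: R] (fun x => (b x)%:E) by exact/measurable_EFinP.
have maE : measurable_fun [set: R] (fun x => (a x)%:E) by exact/measurable_EFinP.
have miE (c d : R) : measurable_fun [set: R]
    (fun x : R => (\1_`[c, d] (fracpart x) : R)%:E).
  by apply/measurable_EFinP; exact: mi.
have mKuE u : measurable_fun [set: R] (fun x => (K (x - u))%:E).
  apply/measurable_EFinP; apply: (measurableT_comp (trigpoly_measurable tK)).
  exact: measurable_funB.
have mcst (c : R) : measurable_fun [set: R] (fun _ : R => c%:E) by [].
have int_cst (c : R) : (\int[lam]_x c%:E = c%:E)%E.
  by rewrite integral_cst// [X in (_ * X)%E](@probability_setT _ _ _ lam) mule1.
have inner x : (\int[lam]_u (K (x - u) * `|G x - G u|)%:E <=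
    (a x + (eps / 8 + eps / 4 + 2 * C * b x))%:E +
    \int[lam]_u (K (x - u) * a u)%:E)%E.
  have c0 : 0 <= a x + eps / 8 + 2 * C * b x.
    by rewrite !addr_ge0// ?mulr_ge0// ?ltW// mulr_gt0.
  have mKa : measurable_fun [set: R] (fun u => (K (x - u) * a u)%:E).
    by apply/measurable_EFinP; exact: measurable_funM.
  have mKc : measurable_fun [set: R]
      (fun u => (K (x - u) * (a x + eps / 8 + 2 * C * b x))%:E).
    by apply/measurable_EFinP; exact: measurable_funM.
  have mcKa : measurable_fun [set: R] (fun u => (eps / 4)%:E + (K (x - u) * a u)%:E)%E.
    exact: emeasurable_funD.
  have mKG : measurable_fun [set: R] (fun u => (K (x - u) * `|G x - G u|)%:E).
    apply/measurable_EFinP; apply: measurable_funM => //.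
    apply: (measurableT_comp (@normr_measurable R setT)); exact: measurable_funB.
  have e40 : (0%:E <= (eps / 4)%:E)%E by rewrite lee_fin divr_ge0// ltW.
  have Ka0 u : (0%:E <= (K (x - u) * a u)%:E)%E by rewrite lee_fin mulr_ge0.
  have Kc0 u : (0%:E <= (K (x - u) * (a x + eps / 8 + 2 * C * b x))%:E)%E.
    by rewrite lee_fin mulr_ge0.
  apply: (@le_trans _ _ (\int[lam]_u
    ((K (x - u) * (a x + eps / 8 + 2 * C * b x))%:E +
     ((eps / 4)%:E + (K (x - u) * a u)%:E)))%E).
    apply: ge0_le_integral => //=.
    - by move=> u _; rewrite lee_fin mulr_ge0.
    - exact: emeasurable_funD mKc mcKa.
    - by move=> u _; rewrite lee_fin.
  rewrite ge0_integralD//=; last by move=> u _; exact: adde_ge0.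
  rewrite ge0_integralD//= int_cst.
  under eq_integral do rewrite EFinM.
  rewrite ge0_integralZr//=; last 2 first.
    exact: mKxE.
    by move=> u _; rewrite lee_fin.
  rewrite integral_kernelN// mul1e addeA -EFinD.
  by rewrite leeD2r// lee_fin; lra.
have mKa2 : measurable_fun [set: R * R] (fun z => (K (z.1 - z.2) * a z.2)%:E).
  apply/measurable_EFinP/measurable_funM => //.
  exact: (measurableT_comp ma measurable_snd).
have Ka20 (z : R * R) : (0%:E <= (K (z.1 - z.2) * a z.2)%:E)%E.
  by rewrite lee_fin mulr_ge0.
have mB : measurable_fun [set: R] (fun x => \int[lam]_u (K (x - u) * a u)%:E)%E.
  exact: (measurable_fun_fubini_tonelli_F (m2 := lam) _ mKa2 Ka20).
have mG2 : measurable_fun [set: R * R]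
    (fun z => (K (z.1 - z.2) * `|G z.1 - G z.2|)%:E).
  apply/measurable_EFinP/measurable_funM => //.
  apply: (measurableT_comp (@normr_measurable R setT)); apply: measurable_funB.
    exact: (measurableT_comp mG measurable_fst).
  exact: (measurableT_comp mG measurable_snd).
have mQ : measurable_fun [set: R]
    (fun x => \int[lam]_u (K (x - u) * `|G x - G u|)%:E)%E.
  apply: (measurable_fun_fubini_tonelli_F (m2 := lam) _ mG2).
  by move=> z; rewrite lee_fin mulr_ge0.
have mCb : measurable_fun [set: R] (fun x => (2 * C * b x)%:E).
  by apply/measurable_EFinP; exact: measurable_funM.
have mcb : measurable_fun [set: R] (fun x => (eps / 8 + eps / 4 + 2 * C * b x)%:E).
  by apply/measurable_EFinP; apply: measurable_funD => //; exact: measurable_funM.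
have mA : measurable_fun [set: R]
    (fun x => (a x + (eps / 8 + eps / 4 + 2 * C * b x))%:E).
  by apply/measurable_EFinP; apply: measurable_funD => //; exact/measurable_EFinP.
have Cb0 x : 0 <= 2 * C * b x by rewrite mulr_ge0// mulr_ge0// ltW.
have c0 : 0 <= eps / 8 + eps / 4 by lra.
have A0 x : (0%:E <= (a x + (eps / 8 + eps / 4 + 2 * C * b x))%:E)%E.
  by rewrite lee_fin !addr_ge0// ltW//; lra.
have B0 x : (0%:E <= \int[lam]_u (K (x - u) * a u)%:E)%E.
  by apply: integral_ge0 => u _; rewrite lee_fin mulr_ge0.
apply: (@le_trans _ _ (\int[lam]_x ((a x + (eps / 8 + eps / 4 + 2 * C * b x))%:E +
    \int[lam]_u (K (x - u) * a u)%:E))%E).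
  apply: ge0_le_integral => //=.
  - by move=> x _; apply: integral_ge0 => u _; rewrite lee_fin mulr_ge0.
  - exact: emeasurable_funD mA mB.
rewrite ge0_integralD//=.
(* Tonelli moves the integral over x inside, where the kernel integrates to 1. *)
have intB : (\int[lam]_x \int[lam]_u (K (x - u) * a u)%:E <= (eps / 8)%:E)%E.
  rewrite (fubini_tonelli (m1 := lam) (m2 := lam) _ mKa2 Ka20)/=.
  apply: le_trans hphi; rewrite le_eqVlt; apply/orP; left; apply/eqP.
  apply: eq_integral => u _; under eq_integral do rewrite EFinM.
  rewrite ge0_integralZr//=; last 3 first.
    exact: mKuE.
    by move=> x _; rewrite lee_fin.
    by rewrite lee_fin.
  by rewrite integral_kernel// mul1e.
have intb : (\int[lam]_x (b x)%:E <= (del + del)%:E)%E.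
  under eq_integral do rewrite EFinD.
  rewrite ge0_integralD//=; [|exact: miE|exact: miE].
  rewrite EFinD leeD//.
    by rewrite -[X in (_ <= X%:E)%E]subr0 integral_unif_indic_fracpart// ltW.
  rewrite [X in (_ <= X%:E)%E](_ : del = 1 - (1 - del)); last by ring.
  by rewrite integral_unif_indic_fracpart// gerBl ltW.
have intA : (\int[lam]_x (a x + (eps / 8 + eps / 4 + 2 * C * b x))%:E <=
    (eps / 8 + (eps / 8 + eps / 4 + 2 * C * (del + del)))%:E)%E.
  under eq_integral do rewrite EFinD.
  rewrite ge0_integralD//=; last 2 first.
    by move=> x _; rewrite lee_fin.
    by move=> x _; rewrite lee_fin addr_ge0.
  rewrite [leRHS]EFinD; apply: leeD; first exact: hphi.
  under eq_integral do rewrite EFinD.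
  rewrite ge0_integralD//=; last by move=> x _; rewrite lee_fin.
  rewrite int_cst [leRHS]EFinD leeD2l//.
  under eq_integral do rewrite EFinM.
  rewrite ge0_integralZl//=; last 2 first.
    by move=> x _; rewrite lee_fin.
    by rewrite lee_fin mulr_ge0// ltW.
  by rewrite [leRHS]EFinM lee_wpmul2l// lee_fin mulr_ge0// ltW.
apply: (le_trans (leeD intA intB)); rewrite -EFinD lee_fin.
have : 2 * C * (del + del) <= eps / 4.
  apply: (@le_trans _ _ (2 * C * (eps / (16 * C) + eps / (16 * C)))).
    by apply: ler_wpM2l; [rewrite mulr_ge0// ltW|rewrite lerD].
  by rewrite le_eqVlt; apply/orP; left; apply/eqP; field; rewrite gt_eqF.
lra.
Qed.

End kernel_approximation.

(** * Convergence to zero in the complex plane and in the extended reals *)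

Lemma cvg_complex0P (R : realType) (a b : nat -> R) :
  (a M +i* b M) @[M --> \oo] --> (0 : R[i]^o) <->
  a @ \oo --> (0 : R) /\ b @ \oo --> (0 : R).
Proof.
have normE (x y : R) : `|0 - (x +i* y) : R[i]^o| = (Num.sqrt (x ^+ 2 + y ^+ 2))%:C.
  by rewrite sub0r normrN normc_def.
split=> [h|[ha hb]].
  have h' e : 0 < e -> \forall M \near \oo, Num.sqrt (a M ^+ 2 + b M ^+ 2) < e.
    move=> e0; have e0C : 0 < e%:C :> R[i] by rewrite ltcR.
    have H := (@cvgrPdist_lt R[i] R[i]^o nat (nbhs \oo) eventually_filter _ _).1 h _ e0C.
    apply: filterS H => M.
    by rewrite normE ltcR.
  have le1 (x y : R) : `|x| <= Num.sqrt (x ^+ 2 + y ^+ 2).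
    by rewrite -sqrtr_sqr ler_sqrt ?addr_ge0 ?sqr_ge0// lerDl sqr_ge0.
  split; apply/cvgrPdist_lt => e /h'; apply: filterS => M; rewrite sub0r normrN.
    by apply: le_lt_trans.
  by apply: le_lt_trans; rewrite addrC.
apply: (@cvgrPdist_lt R[i] R[i]^o nat (nbhs \oo) eventually_filter _ _).2.
(* A positive complex tolerance has imaginary part 0. *)
move=> -[e e'] /=; rewrite ltcE/= => /andP[/eqP -> e0].
have e2 : 0 < e / 2 by rewrite divr_gt0.
have /cvgrPdist_lt/(_ _ e2) Ha := ha; have /cvgrPdist_lt/(_ _ e2) Hb := hb.
near=> M; rewrite normE -[X in _ < X]/(e%:C) ltcR.
have h1 : `|a M| < e / 2 by rewrite -normrN -sub0r; near: M.
have h2 : `|b M| < e / 2 by rewrite -normrN -sub0r; near: M.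
rewrite -(ger0_norm (ltW e0)) -sqrtr_sqr ltr_sqrt ?exprn_gt0//.
move: h1 h2; rewrite !ltr_norml => /andP[a1 a2] /andP[b1 b2]; nra.
Unshelve. all: by end_near. Qed.

Lemma ge0_cvge0 (R : realType) (u : nat -> \bar R) :
  (forall n, 0 <= u n)%E ->
  (forall e : R, 0 < e -> \forall n \near \oo, (u n <= e%:E)%E) ->
  u @ \oo --> 0%E.
Proof.
move=> u0 h.
have fin x e : (0 <= x)%E -> (x <= e%:E)%E -> x \is a @fin_num R.
  by move=> x0 xe; rewrite ge0_fin_numE// (le_lt_trans xe)// ltry.
apply/fine_cvgP; split.
  by apply: filterS (h 1 ltr01) => n; exact: fin.
apply/cvgrPdist_le => e e0; apply: filterS (h e e0) => n une.
rewrite sub0r normrN ger0_norm ?fine_ge0//= -lee_fin fineK//; exact: fin une.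
Qed.

Lemma cvge0_fine_le (R : realType) (u : nat -> \bar R) (e : R) :
  u @ \oo --> 0%E -> 0 < e -> \forall n \near \oo,
  (u n \is a fin_num) /\ `|fine (u n)| <= e.
Proof.
move=> /fine_cvgP[hfin /cvgrPdist_le h] e0.
apply: filterS (filterI hfin (h e e0)) => n [/= ufin]; rewrite sub0r normrN.
by move=> ue; split.
Qed.

(** Brings plain integrals over [0, 1[ under the density lemmas, with density 1. *)
Lemma is_density_unif (R : realType) :
  is_density (unif R) `[0, 1[ (fun x : R => x) (fun=> 1).
Proof.
split=> // A mA; rewrite preimage_id.
rewrite -[X in _ X = _]setIT -integral_indic// integral_unif//; last first.
  by apply/measurable_EFinP; exact: measurable_indic.
rewrite [RHS]integral_mkcondr; apply: eq_integral => x _.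
by rewrite patchE indicE; case: ifP.
Qed.

(** * Smoothing the law of a sum modulo one *)

Section sum_mod_one.
Context (d : measure_display) (T : measurableType d) (R : realType)
  (P : probability T R) (L V : T -> R) (g : R -> R).
Hypotheses (mL : measurable_fun setT L) (mV : measurable_fun setT V)
  (LV : indep2 P L V) (Lg : is_density P `[0, 1[ (fun t => fracpart (L t)) g).
Local Notation lam := (unif R).
(** The 1-periodic extension of g, for which translates make sense. *)
Let G (x : R) : R := g (fracpart x).
Let S (t : T) : R := L t + V t.

Lemma measurable_periodic_density : measurable_fun setT G.
Proof.
have [mg _ _] := Lg.
apply: (@measurable_comp _ _ _ R R R `[0, 1[%classic g setT (@fracpart R)) => //.
  by move=> _ [x _ <-]; exact: fracpart_itv.
exact: measurable_fracpart.
Qed.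
Let mG := measurable_periodic_density.

Let mGE : measurable_fun [set: R] (fun x => (G x)%:E).
Proof. exact/measurable_EFinP. Qed.

Let G0 x : 0 <= G x.
Proof. by have [_ g0 _] := Lg; apply: g0; exact: fracpart_itv. Qed.

Let GE0 (x : R) : (0%:E <= (G x)%:E)%E.
Proof. by rewrite lee_fin. Qed.

Let Gper x (k : int) : G (x + k%:~R) = G x.
Proof. by rewrite /G fracpartDz. Qed.

Let mfL : measurable_fun setT (fun t => fracpart (L t)).
Proof. exact: (measurableT_comp (@measurable_fracpart R)). Qed.

Let mS : measurable_fun setT S.
Proof. exact: measurable_funD. Qed.

Lemma ge0_integral_periodic_density (F : R -> \bar R) :
  measurable_fun setT F -> (forall x, 0 <= F x)%E ->
  (\int[P]_t F (fracpart (L t)) = \int[lam]_u (F u * (G u)%:E))%E.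
Proof.
move=> mF F0; rewrite (ge0_integral_density _ mfL Lg mF F0)//.
rewrite integral_unif; last 2 first.
  exact: emeasurable_funM.
  by move=> x; rewrite mule_ge0.
by apply: eq_integral => x; rewrite inE/= in_itv/= => x01; rewrite /G fracpart_id.
Qed.

Lemma integral_periodic_density : (\int[lam]_u (G u)%:E = 1)%E.
Proof.
have := @ge0_integral_periodic_density (cst 1%E).
rewrite integral_cst// [X in (1 * X)%E](@probability_setT _ _ _ P) mul1e => ->//.
by apply: eq_integral => u _; rewrite mul1e.
Qed.

Lemma integrable_periodic_density : lam.-integrable setT (EFin \o G).
Proof.
apply/integrableP; split; first exact/measurable_EFinP.
under eq_integral do rewrite /= ger0_norm//.
by rewrite integral_periodic_density ltry.
Qed.

Lemma ge0_integral_indep_density (F : R * R -> \bar R) :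
  measurable_fun setT F -> (forall x, 0 <= F x)%E ->
  (\int[P]_t F (fracpart (L t), V t) =
   \int[P]_t \int[lam]_u (F (u, V t) * (G u)%:E))%E.
Proof.
move=> mF F0.
pose F' (z : R * R) := F (fracpart z.1, z.2).
have mF' : measurable_fun setT F'.
  apply: (measurableT_comp mF); apply/measurable_fun_pairP; split=> /=.
    exact: (measurableT_comp (@measurable_fracpart R) measurable_fst).
  exact: measurable_snd.
rewrite (@indep2_ge0_integral _ _ _ _ _ _ F' mL mV LV mF')//; last by move=> z; exact: F0.
apply: eq_integral => t _.
rewrite -(@ge0_integral_periodic_density (fun u => F (u, V t)))//.
apply: (measurableT_comp mF); apply/measurable_fun_pairP.
by split; [exact: measurable_id|exact: measurable_cst].
Qed.

Let indE (A : set R) : measurable A -> measurable_fun [set: R]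
  (fun x : R => (\1_A (fracpart x) : R)%:E).
Proof.
move=> mA; apply/measurable_EFinP; apply: (measurableT_comp _ (@measurable_fracpart R)).
exact: measurable_indic.
Qed.

Let ind0 (A : set R) (x : R) : (0%:E <= (\1_A x : R)%:E)%E.
Proof. by rewrite lee_fin. Qed.

Lemma prob_fracpart_sum (A : set R) : measurable A ->
  P ((fun t => fracpart (S t)) @^-1` A) =
  (\int[P]_t \int[lam]_u ((\1_A (fracpart (u + V t)))%:E * (G u)%:E))%E.
Proof.
move=> mA.
rewrite -(@ge0_integral_indep_density (fun z : R * R => (\1_A (fracpart (z.1 + z.2)) : R)%:E))//; last first.
  apply: (measurableT_comp (indE mA)).
  exact: (measurable_funD measurable_fst measurable_snd).
have mfS : measurable_fun setT (fun t => fracpart (S t)).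
  exact: (measurableT_comp (@measurable_fracpart R)).
rewrite -[X in P X = _]setIT -integral_indic//; last first.
  by rewrite -[X in measurable X]setTI; exact: mfS.
apply: eq_integral => t _ /=; rewrite fracpart_fracpartDl.
by rewrite !indicE; congr (_ %:R%:E).
Qed.

(** The density of L + V mod 1: the translates of g averaged over the law of V. It may be infinite
    at some points. *)
Let H (x : R) : \bar R := (\int[P]_t (G (x - V t))%:E)%E.

Let mG2 : measurable_fun [set: R * T] (fun z => (G (z.1 - V z.2))%:E).
Proof.
apply: (measurableT_comp mGE); apply: measurable_funB; first exact: measurable_fst.
exact: (measurableT_comp mV measurable_snd).
Qed.

Let mH : measurable_fun [set: R] H.
Proof. exact: (measurable_fun_fubini_tonelli_F (m2 := P) _ mG2). Qed.

Let H0 x : (0 <= H x)%E.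
Proof. exact: integral_ge0. Qed.

(** For each outcome, rotating u by V t moves the translation from the indicator to G; Tonelli then
    averages over t first. *)
Let prob_fracpart_sumE (A : set R) : measurable A ->
  P ((fun t => fracpart (S t)) @^-1` A) =
  (\int[lebesgue_measure]_(x in `[0%R, 1%R[ `&` A) H x)%E.
Proof.
move=> mA; rewrite prob_fracpart_sum//.
transitivity (\int[P]_t \int[lam]_u
    ((\1_A (fracpart u))%:E * (G (u - V t))%:E))%E.
  apply: eq_integral => t _.
  pose F (y : R) := ((\1_A (fracpart y) : R)%:E * (G (y - V t))%:E)%E.
  have mF : measurable_fun [set: R] F.
    apply: emeasurable_funM; first exact: indE.
    by apply: (measurableT_comp mGE); exact: measurable_funB.
  have F0 y : (0 <= F y)%E by rewrite /F mule_ge0.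
  have FE y : F (fracpart y) = F y.
    have [k ->] := fracpartE y.
    by rewrite /F fracpartDz addrAC Gper.
  transitivity (\int[lam]_u F (fracpart (u + V t)%R))%E.
    by apply: eq_integral => u _; rewrite FE /F addrK.
  by rewrite ge0_integral_unif_rot//; apply: eq_integral => u _; rewrite FE.
pose F (z : R * T) := ((\1_A (fracpart z.1) : R)%:E * (G (z.1 - V z.2))%:E)%E.
have mF : measurable_fun setT F.
  apply: emeasurable_funM => //.
  exact: (measurableT_comp (indE mA) measurable_fst).
rewrite -(fubini_tonelli (m1 := lam) (m2 := P) F)//; last first.
  by move=> z; rewrite /F mule_ge0.
transitivity (\int[lam]_u ((\1_A (fracpart u))%:E * H u))%E.
  apply: eq_integral => u _; rewrite /F/= ge0_integralZl//.
  apply: (measurableT_comp mGE); exact: measurable_funB.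
rewrite integral_unif; last 2 first.
  by apply: emeasurable_funM => //; exact: indE.
  by move=> x; rewrite mule_ge0.
rewrite [RHS]integral_mkcondr; apply: eq_integral => x; rewrite inE/= in_itv/= => x01.
by rewrite patchE fracpart_id// indicE; case: ifP => _; rewrite ?mul1e ?mul0e.
Qed.

(** [H] has integral 1, so it is finite almost everywhere and [fine] alters it only on a null
    set. *)
Lemma exists_density_fracpart_sum :
  exists h, is_density P `[0, 1[ (fun t => fracpart (S t)) h.
Proof.
exists (fine \o H); split.
- by apply: measurable_funTS; apply: (measurableT_comp _ mH).
- by move=> x _; exact: fine_ge0.
- move=> A mA; rewrite prob_fracpart_sumE//.
  have iH : lebesgue_measure.-integrable `[0, 1[%classic H.
    apply/integrableP; split; first exact: measurable_funTS.
    under eq_integral do rewrite gee0_abs//.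
    have := prob_fracpart_sumE measurableT; rewrite setIT preimage_setT => <-.
    by rewrite [X in (X < _)%E](@probability_setT _ _ _ P) ltry.
  apply: ge0_ae_eq_integral => //.
  + exact: measurableI.
  + exact: measurable_funTS.
  + apply: measurable_funTS; apply/measurable_EFinP; exact: (measurableT_comp _ mH).
  + by move=> x _; rewrite lee_fin fine_ge0.
  have := integrable_ae _ iH; move=> /(_ (measurable_itv _)).
  by apply: filterS => x h [Ix Ax]; rewrite /= fineK// h.
Qed.

Section kernel_smoothing.
Variable K : R -> R.
Hypotheses (tK : trigpoly K) (K0 : forall x, 0 <= K x)
  (K1 : \int[lam]_x K x = 1).
Let Q := (\int[lam]_x \int[lam]_u (K (x - u) * `|G x - G u|)%:E)%E.
(** The indicator of A convolved with K; E Phi(S) is the mass that the smoothed law of S gives to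
    A. *)
Let Phi (A : set R) (y : R) :=
  (\int[lam]_x (\1_A (fracpart x) * K (x - y))%:E)%E.

Let mind2 (A : set R) (v : R) : measurable A ->
  measurable_fun [set: R * R] (fun z => \1_A (fracpart (z.1 + v)) : R).
Proof.
move=> mA; apply: (measurableT_comp (measurable_indic mA)).
apply: (measurableT_comp (@measurable_fracpart R)).
by apply: measurable_funD => //; exact: measurable_fst.
Qed.

Let smoothing_shift (A : set R) (u v : R) : measurable A ->
  Phi A (u + v) = (\int[lam]_x (\1_A (fracpart (x + v)) * K (x - u))%:E)%E.
Proof.
move=> mA; pose F y := (\1_A (fracpart y) * K (y - (u + v)))%:E.
have mF : measurable_fun [set: R] F.
  apply/measurable_EFinP; apply: measurable_funM.
    by apply/measurable_EFinP; exact: indE.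
  apply: (measurableT_comp (trigpoly_measurable tK)).
  exact: measurable_funB.
have F0 y : (0%:E <= F y)%E by rewrite lee_fin mulr_ge0.
have FE y : F (fracpart y) = F y.
  have [k ->] := fracpartE y.
  by rewrite /F fracpartDz addrAC trigpoly_period.
transitivity (\int[lam]_x F (fracpart x))%E.
  by apply: eq_integral => x _; rewrite FE.
rewrite -(ge0_integral_unif_rot v)//; apply: eq_integral => x _.
by rewrite FE /F; congr (_ * K _)%:E; ring.
Qed.

(** The comparison for a frozen value v of V. In the double integral, G u <= G x + |G x - G u|
    replaces G u by G x; the error is at most Q because the indicator is at most 1, and Q does not
    depend on v. *)
Let smoothing_le (A : set R) (v : R) : measurable A ->
  (\int[lam]_u (Phi A (u + v) * (G u)%:E) <=
   \int[lam]_u ((\1_A (fracpart (u + v)))%:E * (G u)%:E) + Q)%E.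
Proof.
move=> mA.
have mK := trigpoly_measurableB tK.
have mG1 : measurable_fun [set: R * R] (fun z => G z.1).
  exact: (measurableT_comp mG measurable_fst).
have mG2' : measurable_fun [set: R * R] (fun z => G z.2).
  exact: (measurableT_comp mG measurable_snd).
pose f1 (z : R * R) : R := \1_A (fracpart (z.1 + v)) * K (z.1 - z.2) * G z.2.
pose f2 (z : R * R) : R := \1_A (fracpart (z.1 + v)) * G z.1 * K (z.1 - z.2).
pose f3 (z : R * R) : R := K (z.1 - z.2) * `|G z.1 - G z.2|.
have mi := mind2 v mA.
have mf1 : measurable_fun [set: R * R] (EFin \o f1).
  by apply/measurable_EFinP; do 2 apply: measurable_funM => //.
have mf2 : measurable_fun [set: R * R] (EFin \o f2).
  by apply/measurable_EFinP; do 2 apply: measurable_funM => //.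
have mf3 : measurable_fun [set: R * R] (EFin \o f3).
  apply/measurable_EFinP; apply: measurable_funM => //.
  by apply: (measurableT_comp (@normr_measurable R setT)); exact: measurable_funB.
have i0 x : 0 <= (\1_A x : R) by [].
have f10 z : (0%:E <= (EFin \o f1) z)%E by rewrite lee_fin !mulr_ge0.
have f20 z : (0%:E <= (EFin \o f2) z)%E by rewrite lee_fin !mulr_ge0.
have f30 z : (0%:E <= (EFin \o f3) z)%E by rewrite lee_fin !mulr_ge0.
have key (c w k a b : R) : 0 <= c -> c <= 1 -> 0 <= w -> 0 <= k -> b <= a + w ->
    c * k * b <= c * a * k + k * w.
  move=> c0 c1 w0 k0 ab; apply: (@le_trans _ _ (c * k * (a + w))).
    by apply: ler_wpM2l => //; rewrite mulr_ge0.
  have kw : c * (k * w) <= k * w by rewrite ler_piMl// mulr_ge0.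
  by rewrite mulrDr (mulrAC c a) lerD2l -mulrA.
have sec (f : R * R -> R) (u : R) : measurable_fun [set: R * R] (EFin \o f) ->
    measurable_fun [set: R] (fun x => (f (x, u))%:E).
  move=> mf; apply: (measurableT_comp mf); apply/measurable_fun_pairP.
  by split; [exact: measurable_id|exact: measurable_cst].
have -> : (\int[lam]_u (Phi A (u + v) * (G u)%:E) =
    \int[lam]_u \int[lam]_x (f1 (x, u))%:E)%E.
  apply: eq_integral => u _; rewrite smoothing_shift// -ge0_integralZr//=.
    apply/measurable_EFinP; apply: measurable_funM.
      apply: (measurableT_comp (measurable_indic mA)).
      apply: (measurableT_comp (@measurable_fracpart R)).
      exact: measurable_funD.
    apply: (measurableT_comp (trigpoly_measurable tK)); exact: measurable_funB.
  by move=> x _; rewrite lee_fin mulr_ge0.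
apply: (@le_trans _ _ (\int[lam]_u \int[lam]_x ((f2 (x, u))%:E + (f3 (x, u))%:E))%E).
  apply: ge0_le_integral => //=.
  - by move=> u _; apply: integral_ge0 => x _; exact: (f10 (x, u)).
  - exact: (measurable_fun_fubini_tonelli_G (m1 := lam) _ mf1 f10).
  - apply: (measurable_fun_fubini_tonelli_G (m1 := lam)
      (fun z => (f2 z)%:E + (f3 z)%:E)%E).
      exact: emeasurable_funD mf2 mf3.
    by move=> z; exact: adde_ge0 (f20 z) (f30 z).
  - move=> u _; apply: ge0_le_integral => //=.
    + by move=> x _; exact: (f10 (x, u)).
    + exact: (sec f1 u mf1).
    + exact: (emeasurable_funD (sec f2 u mf2) (sec f3 u mf3)).
    move=> x _; rewrite -EFinD lee_fin /f1 /f2 /f3/=.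
    have [c0 c1] : 0 <= (\1_A (fracpart (x + v)) : R) /\ (\1_A (fracpart (x + v)) : R) <= 1.
      by rewrite indicE; case: (_ \in _).
    have ab : G u <= G x + `|G x - G u|.
      by have := ler_norm (G u - G x); rewrite distrC; lra.
    exact: key.
have mJ2 : measurable_fun [set: R] (fun u => \int[lam]_x (f2 (x, u))%:E)%E.
  exact: (measurable_fun_fubini_tonelli_G (m1 := lam) _ mf2 f20).
have mJ3 : measurable_fun [set: R] (fun u => \int[lam]_x (f3 (x, u))%:E)%E.
  exact: (measurable_fun_fubini_tonelli_G (m1 := lam) _ mf3 f30).
have -> : (\int[lam]_u \int[lam]_x ((f2 (x, u))%:E + (f3 (x, u))%:E) =
    \int[lam]_u (\int[lam]_x (f2 (x, u))%:E + \int[lam]_x (f3 (x, u))%:E))%E.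
  apply: eq_integral => u _; rewrite ge0_integralD//.
  - by move=> x _; exact: (f20 (x, u)).
  - exact: (sec f2 u mf2).
  - by move=> x _; exact: (f30 (x, u)).
  - exact: (sec f3 u mf3).
rewrite ge0_integralD//; last 2 first.
  by move=> u _; apply: integral_ge0 => x _; exact: (f20 (x, u)).
  by move=> u _; apply: integral_ge0 => x _; exact: (f30 (x, u)).
(* With u as the inner variable, the kernel in [f2] integrates to 1, and [f3] gives Q. *)
rewrite -(fubini_tonelli (m1 := lam) (m2 := lam) _ mf2 f20)/=.
rewrite -(fubini_tonelli (m1 := lam) (m2 := lam) _ mf3 f30)/=.
rewrite leeD2r// le_eqVlt; apply/orP; left; apply/eqP.
apply: eq_integral => x _; rewrite /f2/=.
under eq_integral do rewrite EFinM.
rewrite ge0_integralZl//=; last 3 first.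
  apply/measurable_EFinP; apply: (measurableT_comp (trigpoly_measurable tK)).
  exact: measurable_funB.
  by move=> u _; rewrite lee_fin.
  by rewrite lee_fin mulr_ge0.
by rewrite integral_kernelN// mule1 EFinM.
Qed.

(* One direction of the total variation bound is enough: it is applied to the
   set where the density is less than 1. *)
Lemma smoothing_lower_bound (A : set R) (eta : R) : measurable A -> eta <= 1 ->
  (forall x, 1 - eta <= \int[P]_t K (x - S t)) ->
  ((1 - eta)%:E * \int[lam]_x (\1_A (fracpart x))%:E <=
   P ((fun t => fracpart (S t)) @^-1` A) + Q)%E.
Proof.
move=> mA eta1 hK; have mK := trigpoly_measurable tK.
have [b hb] := trigpoly_bounded tK.
have mKS : measurable_fun [set: R * T] (fun z => K (z.1 - S z.2)).
  apply: (measurableT_comp mK); apply: measurable_funB; first exact: measurable_fst.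
  exact: (measurableT_comp mS measurable_snd).
have miR : measurable_fun [set: R] (fun x : R => \1_A (fracpart x) : R).
  apply: (measurableT_comp (measurable_indic mA)); exact: measurable_fracpart.
pose f (z : R * T) : R := \1_A (fracpart z.1) * K (z.1 - S z.2).
have mf : measurable_fun [set: R * T] (EFin \o f).
  apply/measurable_EFinP; apply: measurable_funM => //.
  exact: (measurableT_comp miR measurable_fst).
have f0 z : (0%:E <= (EFin \o f) z)%E by rewrite lee_fin mulr_ge0.
(* The lower bound on E K(x - S) is integrated over x in A. *)
apply: (@le_trans _ _ (\int[lam]_x \int[P]_t (f (x, t))%:E)%E).
  rewrite -ge0_integralZl//; [|exact: indE|by rewrite lee_fin subr_ge0].
  apply: ge0_le_integral => //=.
  - by move=> x _; rewrite mule_ge0// ?lee_fin ?subr_ge0.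
  - apply: emeasurable_funM => //; exact: indE.
  - exact: (measurable_fun_fubini_tonelli_F (m2 := P) _ mf f0).
  - move=> x _; under eq_integral do rewrite EFinM.
    rewrite /= ge0_integralZl//; last 2 first.
      apply/measurable_EFinP; apply: (measurableT_comp mK); exact: measurable_funB.
      by move=> t _; rewrite lee_fin.
    rewrite muleC; apply: lee_wpmul2l; first exact: ind0.
    rewrite -EFin_Rintegral ?lee_fin//.
    apply: (@le_cst_integrable _ _ _ _ _ b) => //.
    by apply: (measurableT_comp mK); exact: measurable_funB.
rewrite (fubini_tonelli (m1 := lam) (m2 := P) _ mf f0)/=.
have Phi0 y : (0 <= Phi A y)%E.
  by apply: integral_ge0 => x _; rewrite lee_fin mulr_ge0.
have mPhi : measurable_fun [set: R] (Phi A).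
  apply: (measurable_fun_fubini_tonelli_G (m1 := lam)
    (fun z : R * R => (\1_A (fracpart z.1) * K (z.1 - z.2))%:E)).
    apply/measurable_EFinP; apply: measurable_funM.
      exact: (measurableT_comp miR measurable_fst).
    exact: trigpoly_measurableB.
  by move=> z; rewrite lee_fin mulr_ge0.
(* After Tonelli this is E Phi(S); periodicity of K allows L t to be reduced mod 1, as the density
   of [fracpart (L t)] requires. *)
have -> : (\int[P]_t \int[lam]_x (f (x, t))%:E =
    \int[P]_t Phi A (fracpart (L t) + V t))%E.
  apply: eq_integral => t _; apply: eq_integral => x _; rewrite /f/=.
  have [k ->] := fracpartE (L t); congr (_ * _)%:E.
  by rewrite -(trigpoly_period _ (- k) tK); congr K; rewrite intrN /S; ring.
rewrite (@ge0_integral_indep_density (fun z => Phi A (z.1 + z.2)))//; last first.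
  apply: (measurableT_comp mPhi).
  exact: (measurable_funD measurable_fst measurable_snd).
rewrite prob_fracpart_sum//.
have Q0 : (0 <= Q)%E.
  by apply: integral_ge0 => x _; apply: integral_ge0 => u _; rewrite lee_fin mulr_ge0.
have mind : measurable_fun setT (fun t =>
    \int[lam]_u ((\1_A (fracpart (u + V t)))%:E * (G u)%:E))%E.
  apply: (measurable_fun_fubini_tonelli_G (m1 := lam)
    (fun z : R * T => ((\1_A (fracpart (z.1 + V z.2)) : R)%:E * (G z.1)%:E)%E)).
    apply: emeasurable_funM; last exact: (measurableT_comp mGE measurable_fst).
    apply: (measurableT_comp (indE mA)); apply: measurable_funD.
      exact: measurable_fst.
    exact: (measurableT_comp mV measurable_snd).
  by move=> z; rewrite mule_ge0.
have ind_ge0 t : (0 <= \int[lam]_u ((\1_A (fracpart (u + V t)))%:E * (G u)%:E))%E.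
  by apply: integral_ge0 => u _; rewrite mule_ge0.
(* [smoothing_le] is applied with v = V t and averaged over t; the constant Q survives unchanged. *)
apply: (@le_trans _ _ (\int[P]_t
    (\int[lam]_u ((\1_A (fracpart (u + V t)))%:E * (G u)%:E) + Q))%E).
  apply: ge0_le_integral => //=.
  - by move=> t _; apply: integral_ge0 => u _; rewrite mule_ge0.
  - apply: (measurable_fun_fubini_tonelli_G (m1 := lam)
      (fun z : R * T => (Phi A (z.1 + V z.2) * (G z.1)%:E)%E)).
      apply: emeasurable_funM; last exact: (measurableT_comp mGE measurable_fst).
      apply: (measurableT_comp mPhi); apply: measurable_funD.
        exact: measurable_fst.
      exact: (measurableT_comp mV measurable_snd).
    by move=> z; rewrite mule_ge0.
  - exact: emeasurable_funD.
  - by move=> t _; exact: smoothing_le.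
rewrite ge0_integralD//; rewrite integral_cst//.
by rewrite [X in (_ + _ * X <= _)%E](@probability_setT _ _ _ P) mule1.
Qed.

End kernel_smoothing.

End sum_mod_one.

(** * L^1 distance from a density to the uniform one *)

Section L1_distance.
Context (d : measure_display) (T : measurableType d) (R : realType)
  (P : probability T R).
Local Notation mu := (@lebesgue_measure R).

(** As h and 1 have the same integral, the parts of h - 1 above and below 0 have equal mass; the
    lower part is |A| - P(A) for A = {h < 1}, whence the factor 2. *)
Lemma integral_dist_density_le (Y : T -> R) (h : R -> R) (c : R) :
  is_density P `[0, 1[ Y h ->
  (forall A : set R, measurable A ->
    (\int[unif R]_x (\1_A (fracpart x))%:E <= P (Y @^-1` A) + c%:E)%E) ->
  (\int[mu]_(x in `[0%R, 1%R[) `|h x - 1|%:E <= (2 * c)%:E)%E.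
Proof.
move=> Yh hc; have [mh h0 hA] := Yh.
pose I : set R := `[0, 1[%classic.
have mI : measurable I by exact: measurable_itv.
pose A : set R := I `&` h @^-1` `]-oo, 1[.
have mA : measurable A by apply: mh => //; exact: measurable_itv.
have AI : A `<=` I by move=> x [].
have hE : (\int[mu]_(x in I) (h x)%:E = 1)%E.
  have := hA setT measurableT.
  by rewrite preimage_setT setIT => <-; exact: probability_setT.
have muI : (\int[mu]_(x in I) 1%:E = 1)%E.
  have muI1 : mu I = 1%E.
    by rewrite /I lebesgue_measure_itv/= lte_fin ltr01 oppr0 adde0.
  by apply: etrans (integral_cst mu mI 1%E) _; rewrite mul1e; exact: muI1.
have miA : measurable_fun I (fun x => \1_A x : R).
  by apply: measurable_funTS; exact: measurable_indic.
have pE : P (Y @^-1` A) = (\int[mu]_(x in I) (\1_A x * h x)%:E)%E.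
  rewrite hA// integral_mkcondr; apply: eq_integral => x _.
  by rewrite patchE indicE; case: ifP => _; rewrite ?mul1r ?mul0r.
have mE : (\int[unif R]_x (\1_A (fracpart x))%:E =
    \int[mu]_(x in I) (\1_A x)%:E)%E.
  rewrite integral_unif//; last first.
    apply/measurable_EFinP; apply: (measurableT_comp (measurable_indic mA)).
    exact: measurable_fracpart.
  by apply: eq_integral => x; rewrite inE/= in_itv/= => x01; rewrite fracpart_id.
pose J := (\int[mu]_(x in I) `|h x - 1|%:E)%E.
have h0E x : I x -> (0 <= (h x)%:E)%E by move=> Ix; rewrite lee_fin h0.
have mhE : measurable_fun I (fun x => (h x)%:E) by exact/measurable_EFinP.
have miAE : measurable_fun I (fun x => (\1_A x : R)%:E) by exact/measurable_EFinP.
have mAh : measurable_fun I (fun x => (\1_A x * h x)%:E).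
  by apply/measurable_EFinP; exact: measurable_funM.
have mJ : measurable_fun I (fun x => `|h x - 1|%:E).
  apply/measurable_EFinP; apply: (measurableT_comp (@normr_measurable R setT)).
  exact: measurable_funB.
have Ah0 x : I x -> (0 <= (\1_A x * h x)%:E)%E.
  by move=> Ix; rewrite lee_fin mulr_ge0// h0.
have iA1 x : (\1_A x : R) <= 1 by rewrite indicE; case: (_ \in _).
pose p := (\int[mu]_(x in I) (\1_A x * h x)%:E)%E.
pose m := (\int[mu]_(x in I) (\1_A x)%:E)%E.
have p_ge0 : (0 <= p)%E by apply: integral_ge0.
have m_ge0 : (0 <= m)%E by apply: integral_ge0 => x _; rewrite lee_fin.
have J_ge0 : (0 <= J)%E by apply: integral_ge0 => x _; rewrite lee_fin.
have p_le1 : (p <= 1)%E.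
  rewrite -hE; apply: ge0_le_integral => //= x Ix.
  by rewrite lee_fin ler_piMl// h0.
have m_le1 : (m <= 1)%E.
  rewrite -muI; apply: ge0_le_integral => //=.
  by move=> x _; rewrite lee_fin.
have mp : (m <= p + c%:E)%E by rewrite /m /p -mE -pE; exact: hc.
(* The identity |h - 1| = (h - 1) + 2 (1 - h) 1_A, arranged without subtraction so that it can be
   integrated term by term among nonnegative functions. *)
have pointwise x : I x ->
    `|h x - 1| + (1 + (\1_A x * h x + \1_A x * h x)) = h x + (\1_A x + \1_A x).
  move=> Ix; have [h1|h1] := ltP (h x) 1.
    have -> : \1_A x = 1 :> R.
      by rewrite indicE mem_set//; split=> //=; rewrite in_itv.
    by rewrite ltr0_norm ?subr_lt0//; ring.
  have -> : \1_A x = 0 :> R.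
    by rewrite indicE memNset// => -[_ /=]; rewrite in_itv/= ltNge h1.
  by rewrite ger0_norm ?subr_ge0//; ring.
have eqJ : (J + (1 + (p + p)) = 1 + (m + m))%E.
  transitivity (\int[mu]_(x in I) (h x + (\1_A x + \1_A x))%:E)%E; last first.
    under eq_integral do rewrite !EFinD.
    rewrite ge0_integralD//=; last 2 first.
      by move=> x _; rewrite adde_ge0// lee_fin.
      exact: emeasurable_funD.
    by rewrite ge0_integralD//= hE.
  transitivity (\int[mu]_(x in I)
      (`|h x - 1|%:E + (1%:E + ((\1_A x * h x)%:E + (\1_A x * h x)%:E))))%E.
    rewrite ge0_integralD//=; last 2 first.
      by move=> x Ix; rewrite adde_ge0// adde_ge0// Ah0.
      by apply: emeasurable_funD => //; exact: emeasurable_funD.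
    rewrite ge0_integralD//=; last 2 first.
      by move=> x Ix; rewrite adde_ge0// Ah0.
      exact: emeasurable_funD.
    by rewrite ge0_integralD//= muI.
  apply: eq_integral => x; rewrite inE => Ix.
  by rewrite -!EFinD pointwise.
have pfin : p \is a fin_num by rewrite ge0_fin_numE// (le_lt_trans p_le1)// ltry.
have mfin : m \is a fin_num by rewrite ge0_fin_numE// (le_lt_trans m_le1)// ltry.
move: eqJ mp; rewrite -(fineK pfin) -(fineK mfin) -/J.
(* An infinite J contradicts [eqJ] or [J_ge0], so the rest is real arithmetic. *)
move: (fine p) (fine m) J J_ge0 => p' m' [j||]//= j0.
rewrite -!EFinD !lee_fin => -[e] mp; lra.
Qed.

(** Since F has mean 0, E F(Y) is the integral of F (h - 1), and |F| <= 1. *)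
Lemma expectation_le_dist_density (Y : T -> R) (h F : R -> R) :
  measurable_fun setT Y -> is_density P `[0, 1[ Y h ->
  measurable_fun setT F -> (forall x, `|F x| <= 1) ->
  \int[unif R]_x F x = 0 ->
  (`|\int[P]_t F (Y t)|%:E <= \int[mu]_(x in `[0%R, 1%R[) `|h x - 1|%:E)%E.
Proof.
move=> mY Yh mF F1 F0; have [mh h0 hA] := Yh.
pose I : set R := `[0, 1[%classic.
have mI : measurable I by exact: measurable_itv.
have ih := density_integrable mI Yh.
have i1 := density_integrable mI (is_density_unif R).
have mFI : measurable_fun I F by exact: measurable_funTS.
have iFf (f : R -> R) : measurable_fun I f -> mu.-integrable I (EFin \o f) ->
    mu.-integrable I (EFin \o (fun x => F x * f x)).
  move=> mf if_; apply: (@le_integrable _ _ _ mu I mI _ (EFin \o f)) => //.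
    by apply/measurable_EFinP; exact: measurable_funM.
  by move=> x Ix /=; rewrite lee_fin normrM ler_piMl.
have iFh := iFf _ mh ih.
have iF1 : mu.-integrable I (EFin \o (fun x => F x * 1)) by apply: iFf i1.
have EE : \int[P]_t F (Y t) = \int[mu]_(x in I) (F x * h x - F x * 1).
  rewrite (@RintegralB _ _ _ mu I _ _ mI iFh iF1).
  rewrite -(Rintegral_density mI mY Yh mF F1).
  have := @Rintegral_density _ _ R (unif R) I id (fun=> 1) F mI
    (@measurable_id _ _ setT) (is_density_unif R) mF F1.
  by rewrite F0 => <-; rewrite subr0.
have iB : mu.-integrable I (EFin \o (fun x => F x * h x - F x * 1)).
  exact: (@integrableB _ _ _ mu I mI _ _ iFh iF1).
rewrite EE (@EFin_normr_Rintegral _ _ _ mu I _ mI iB).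
apply: le_trans (@le_abse_integral _ _ _ mu I _ mI _) _.
  by have /integrableP[] := iB.
apply: ge0_le_integral => //=.
- apply/measurable_EFinP; apply: (measurableT_comp (@normr_measurable R setT)).
  by apply: measurable_funB; apply: measurable_funM.
- apply/measurable_EFinP; apply: (measurableT_comp (@normr_measurable R setT)).
  exact: measurable_funB.
- by move=> x Ix; rewrite lee_fin -mulrBr normrM ler_piMl.
Qed.
End L1_distance.

(** * Benford's law *)

Section benford.
Context (d : measure_display) (T : measurableType d) (R : realType)
  (P : probability T R) (B : R) (X : nat -> {RV P >-> R}) (g : nat -> R -> R).
Hypotheses (hB : 1 < B) (hX_indep : independent_RVs X)
  (hX_cont : forall m, continuous_RV (X m))
  (hg : forall m,
    is_density P `[0, 1[ (fun t => log_mantissa B (X m t)) (g m)).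
Local Notation S := (logsum B X).

Let mS s : measurable_fun setT (S s).
Proof. exact: measurable_logsum. Qed.

Let mfS s : measurable_fun setT (fun t => fracpart (S s t)).
Proof. exact: (measurableT_comp (@measurable_fracpart R)). Qed.

(** The same summand is split off for every N, so the kernel can be chosen before M. *)
Let S_cons N : S (iota 0 N.+1) = fun t => logb B `|X 0%N t| + S (iota 1 N) t.
Proof. by apply/funext => t; rewrite /logsum big_cons. Qed.

Let indep0 N : indep2 P (fun t => logb B `|X 0%N t|) (S (iota 1 N)).
Proof. by apply: indep2_logsum; rewrite ?iota_uniq// mem_iota. Qed.

Let mL0 : measurable_fun setT (fun t => logb B `|X 0%N t|).
Proof. exact: measurable_logbX. Qed.

Let Lg0 := density_fracpart_log hB hg 0%N.

Lemma benford_fourier_coef0 (n : int) : n != 0 ->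
  cvg_benford_L1 P B (fun M t => \prod_(m < M) X m t) ->
  (\prod_(m < M) fourier_coef (g m) n) @[M --> \oo] --> (0 : R[i]^o).
Proof.
move=> n0 [h [hdens hcvg]].
under eq_fun do rewrite (prod_fourier_coef hB hX_indep hg).
have bound (F : R -> R) : measurable_fun setT F -> (forall x, `|F x| <= 1) ->
    (forall x, F (fracpart x) = F x) -> \int[unif R]_x F x = 0 ->
    \int[P]_t F (S (iota 0 M) t) @[M --> \oo] --> (0 : R).
  move=> mF F1 Ffrac F0; apply/cvgrPdist_le => e e0.
  have he := cvge0_fine_le hcvg e0.
  near=> M; rewrite sub0r normrN.
  (* [cvg_benford_L1] provides densities only for M >= 1. *)
  have M0 : (0 < M)%N by near: M; exact: nbhs_infty_gt.
  have [Jfin Je] : (\int[lebesgue_measure]_(x in `[0%R, 1%R[) `|h M x - 1|%:E)%E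
        \is a fin_num /\
      `|fine (\int[lebesgue_measure]_(x in `[0%R, 1%R[) `|h M x - 1|%:E)%E| <= e.
    by near: M.
  have hM := (is_density_prod hB hX_cont M _ _).1 (hdens M M0).
  have := expectation_le_dist_density (mfS _) hM mF F1 F0.
  under eq_Rintegral do rewrite Ffrac.
  rewrite -(fineK Jfin) lee_fin => /le_trans; apply; apply: le_trans Je.
  exact: ler_norm.
apply/cvg_complex0P; split.
  apply: bound; first exact: measurable_cosz.
  - by move=> x; exact: cosz_le1.
  - by move=> x; exact: cosz_fracpart.
  - exact: Rintegral_unif_cosz.
rewrite -oppr0; apply: cvgN; apply: bound; first exact: measurable_sinz.
- by move=> x; exact: sinz_le1.
- by move=> x; exact: sinz_fracpart.
- exact: Rintegral_unif_sinz.
Unshelve. all: by end_near. Qed.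

Lemma fourier_coef0_benford :
  (forall n : int, n != 0 ->
    (\prod_(m < M) fourier_coef (g m) n) @[M --> \oo] --> (0 : R[i]^o)) ->
  cvg_benford_L1 P B (fun M t => \prod_(m < M) X m t).
Proof.
move=> hF.
have [h0 hh0] : {h0 : nat -> R -> R & forall N, is_density P `[0, 1[
    (fun t => fracpart (S (iota 0 N.+1) t)) (h0 N)}.
  apply: (@choice _ _ (fun N h => is_density P `[0, 1[
    (fun t => fracpart (S (iota 0 N.+1) t)) h)) => N.
  have := exists_density_fracpart_sum mL0 (mS _) (indep0 N) Lg0.
  by rewrite S_cons.
(* The empty product has log-mantissa 0, a point mass without density; the value at M = 0 is
   arbitrary. *)
exists (fun M => if M is N.+1 then h0 N else cst 0); split.
  by move=> [//|N] _; exact/(is_density_prod hB hX_cont).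
apply: ge0_cvge0 => [M|e e0].
  by apply: integral_ge0 => x _; rewrite lee_fin.
have hcs (k : int) : k != 0 ->
    \int[P]_t cosz k (S (iota 0 M) t) @[M --> \oo] --> (0 : R) /\
    \int[P]_t sinz k (S (iota 0 M) t) @[M --> \oo] --> (0 : R).
  move=> k0; have := hF k k0.
  under eq_fun do rewrite (prod_fourier_coef hB hX_indep hg).
  move=> /cvg_complex0P[hc hs]; split=> //.
  rewrite (_ : (fun M => _) = - (fun M => - \int[P]_t sinz k (S (iota 0 M) t))).
    by rewrite -oppr0; exact: cvgN.
  by apply/funext => M; rewrite /= opprK.
have e4 : 0 < e / 4 by rewrite divr_gt0.
have [K [tK K0 K1 KQ]] := kernel_approx (measurable_periodic_density Lg0)
  (integrable_periodic_density mL0 Lg0) e4.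
(* The cap at 1 keeps the factor 1 - eta of the lower bound nonnegative. *)
pose eta := Num.min 1 (e / 4).
have eta0 : 0 < eta by rewrite lt_min ltr01.
have hK := trigpoly_expectation (fun M => mS (iota 0 M))
  (fun k k0 => (hcs k k0).1) (fun k k0 => (hcs k k0).2) tK eta0.
apply: filterS (filterI hK (nbhs_infty_gt 0)) => -[[_ //]|N] [KM _].
(* One e / 4 pays for Q, the other for eta; the 2 comes from the L^1 distance. *)
rewrite (_ : e = 2 * (e / 4 + e / 4)); last by field.
apply: (integral_dist_density_le (hh0 N)) => A mA.
have KM' x : 1 - eta <= \int[P]_t K (x - (logb B `|X 0%N t| + S (iota 1 N) t)).
  have := KM x; rewrite K1 S_cons ler_norml => /andP[a _]; lra.
have eta1 : eta <= 1 by rewrite ge_min lexx.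
have lb := smoothing_lower_bound mL0 (mS _) (indep0 N) Lg0 tK K0 K1 mA eta1 KM'.
rewrite S_cons.
have m0 : (0 <= \int[unif R]_x (\1_A (fracpart x))%:E)%E.
  by apply: integral_ge0 => x _; rewrite lee_fin.
have m1 : (\int[unif R]_x (\1_A (fracpart x))%:E <= 1)%E.
  apply: (@le_trans _ _ (\int[unif R]_x (cst 1%E) x)%E).
    apply: ge0_le_integral => //=.
    - apply/measurable_EFinP; apply: (measurableT_comp (measurable_indic mA)).
      exact: measurable_fracpart.
    - by move=> x _; rewrite lee_fin indicE; case: (_ \in _).
  by rewrite integral_cst// mul1e; exact: probability_le1.
have mfin : (\int[unif R]_x (\1_A (fracpart x))%:E)%E \is a fin_num.
  by rewrite ge0_fin_numE// (le_lt_trans m1)// ltry.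
move: m0 m1 lb; rewrite -(fineK mfin) !lee_fin.
move: (fine _) => m m0 m1 lb.
(* The smoothing bound controls the first part; the second is at most eta because m <= 1. *)
have -> : m%:E = (((1 - eta) * m)%:E + (eta * m)%:E)%E.
  by rewrite -EFinD; congr EFin; ring.
rewrite [(_ + e / 4)%:E]EFinD addeA; apply: leeD.
  by apply: (le_trans lb); exact: leeD2l.
by rewrite lee_fin (@le_trans _ _ eta) ?ger_pMr// ge_min lexx orbT.
Qed.
End benford.

(* X m and g m stand for X_{m+1} and g_{B,m+1}. *)
Theorem theorem1p2 (d : measure_display) (T : measurableType d)
    (R : realType) (P : probability T R) (B : R) (X : nat -> {RV P >-> R})
    (g : nat -> R -> R)
    (hB : 1 < B)
    (hX_indep : independent_RVs X)
    (hX_cont : forall m, continuous_RV (X m))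
    (hg : forall m,
      is_density P `[0, 1[ (fun t => log_mantissa B (X m t)) (g m)) :
  cvg_benford_L1 P B (fun M t => \prod_(m < M) X m t) <->
  (forall n : int, n != 0 ->
    (\prod_(m < M) fourier_coef (g m) n) @[M --> \oo] --> (0 : R[i]^o)).
Proof.
split=> [hcvg n n0|].
  exact: benford_fourier_coef0 hB hX_indep hX_cont hg _ n0 hcvg.
exact: fourier_coef0_benford.
Qed.
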